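(* Let $\Lambda\subset\mathbb{Z}^d$ be finite and nonempty. When $a\in[0,1)$ is irrational and $a=b$, $\mu$ (normalized Lebesgue measure on the set $\mathcal{R}$ of allowed configurations) is the unique invariant probability measure for the CBTW model, and it is ergodic.
   Context: Let $d\ge 1$ and let $\Lambda\subset\mathbb{Z}^d$ be finite and nonempty. Sites $x,y$ are nearest neighbours if $|x-y|=1$ (Euclidean norm). Put $\mathcal{X}=[0,\infty)^\Lambda$ (configurations) and $\Omega=[0,1)^\Lambda$ (stable configurations). Let $\Delta$ be the $|\Lambda|\times|\Lambda|$ matrix with $\Delta(x,x)=1$, $\Delta(x,y)=-\frac1{2d}$ if $|x-y|=1$, and $\Delta(x,y)=0$ otherwise. The toppling operator at $x$ is $T_x\eta=\eta-\Delta(x,\cdot)$; it is legal on $\eta$ if $\eta(x)\ge 1$. It is a known fact that from every $\eta\in\mathcal{X}$, performing legal topplings leads after finitely many steps to a stable configuration, which does not depend on the order of the legal topplings; it is denoted $\mathcal{S}\eta\in\Omega$ (stabilization). With $\delta_x$ the indicator configuration of site $x$, the addition operator is $A_x^u\eta=\mathcal{S}(\eta+u\delta_x)$ for $u\ge 0$. The CBTW sandpile model with $a=b$ is the Markov chain $\eta_t=A_{X_t}^{a}\eta_{t-1}$, $t=1,2,\dots$, on $\Omega$, where $X_1,X_2,\dots$ are i.i.d. uniform on $\Lambda$, independent of $\eta_0$. Write $A_x=A_x^a$. For $\eta\in\Omega$ and nonempty $W\subseteq\Lambda$, the restriction $\eta|_W$ is a forbidden sub-configuration (FSC) if for all $x\in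 W$, $\eta(x)<\frac1{2d}\#\{\text{nearest neighbours of }x\text{ in }W\}$. A configuration $\eta\in\Omega$ is allowed if it has no FSC. $\mathcal{R}$ is the set of allowed configurations (it is mapped into itself by each $A_x$), and $\mu$ is the probability measure $\mu(B)=\mathrm{Vol}(B\cap\mathcal{R})/\mathrm{Vol}(\mathcal{R})$, where $\mathrm{Vol}$ is Lebesgue measure. A probability measure $\nu$ on $\Omega$ is invariant if $\nu(B)=\frac1{|\Lambda|}\sum_{x\in\Lambda}\nu(A_x^{-1}B)$ for all measurable $B$. A bounded measurable function $g$ on $\mathcal{R}$ is $\nu$-invariant if $\frac1{|\Lambda|}\sum_{x\in\Lambda}g(A_x\eta)=g(\eta)$ for $\nu$-almost all $\eta\in\mathcal{R}$. An invariant probability measure $\nu$ on $\mathcal{R}$ is ergodic if every $\nu$-invariant function is $\nu$-a.s. constant. *)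

(* Defs.v *)
From HB Require Import structures.
From mathcomp Require Import all_boot all_order all_algebra finmap.
From mathcomp Require Import all_classical all_reals all_analysis.

Set Implicit Arguments.
Unset Strict Implicit.
Unset Printing Implicit Defensive.

Import Order.TTheory GRing.Theory Num.Theory.
Local Open Scope classical_set_scope.
Local Open Scope ring_scope.

(* R^L for a finite set of sites L, stored as tuples through the enumeration
   of L, so as to inherit the product sigma-algebra of n.-tuple R. *)
Notation config R L := ((#|{: L}|).-tuple R).

Section Configurations.
Context (R : realType) (d : nat) (L : {fset 'rV[int]_d}).
Implicit Types (eta zeta : config R L) (x y : L) (W : {set L}).

Definition height eta x : R := tnth eta (enum_rank x).

Definition mkconfig (f : L -> R) : config R L :=
  [tuple f (enum_val i) | i < #|{: L}|].

End Configurations.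

Definition euclidean_dist (R : realType) (d : nat) (p q : 'rV[int]_d) : R :=
  Num.sqrt (\sum_(i < d) (p ord0 i - q ord0 i)%:~R ^+ 2).

Section Sandpile.
Context (R : realType) (d : nat) (L : {fset 'rV[int]_d}).
Implicit Types (eta zeta : config R L) (x y : L) (W : {set L}).

Definition neighbour x y : bool := euclidean_dist R (val x) (val y) == 1.

Definition Delta x y : R :=
  if x == y then 1 else if neighbour x y then - (2 * d)%:R^-1 else 0.

Definition topple eta x : config R L :=
  mkconfig (fun y => height eta y - Delta x y).

Definition Omega : set (config R L) :=
  [set eta | forall x, 0 <= height eta x < 1].

Fixpoint legal eta (s : seq L) : Prop :=
  if s is x :: s' then 1 <= height eta x /\ legal (topple eta x) s' else True.

Definition stabilizations eta : set (config R L) :=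
  [set zeta | Omega zeta /\
     exists s : seq L, legal eta s /\ zeta = foldl topple eta s].

(* For eta in [0, +oo[^L the set stabilizations eta is a singleton; the
   default value eta of xget only matters for other configurations. *)
Definition stabilize eta : config R L := xget eta (stabilizations eta).

Definition add_op (u : R) x eta : config R L :=
  stabilize (mkconfig (fun y => height eta y + u * (y == x)%:R)).

Definition forbidden eta W : Prop :=
  W != finset.set0 /\
  forall x, x \in W ->
    height eta x < (2 * d)%:R^-1 * #|[set y in W | neighbour x y]%SET|%:R.

Definition allowed : set (config R L) :=
  [set eta | Omega eta /\ ~ exists W, forbidden eta W].

End Sandpile.

Arguments Omega R {d} L.
Arguments allowed R {d} L.

(* Lebesgue measure on R^n, as an iterated product measure. The codomain of
   the reindexing map is forced to be m.+1.-tuple R: by default it would be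
   m.+1.-tuple (measurableTypeR R), which has another display. *)
Fixpoint vol (R : realType) (n : nat) : set (n.-tuple R) -> \bar R :=
  match n return set (n.-tuple R) -> \bar R with
  | 0 => \d_([tuple])
  | m.+1 => pushforward (lebesgue_measure \x vol (R := R) (n := m))%E
              (fun p : measurableTypeR R * m.-tuple R =>
                 [tuple of (p.1 : R) :: p.2] : m.+1.-tuple R)
  end.

Section InvariantMeasures.
Context (R : realType) (d : nat) (L : {fset 'rV[int]_d}).
Implicit Types (a : R) (nu : probability (config R L) R).

Definition normalized_volume nu : Prop :=
  forall B, measurable B ->
    nu B = (fine (vol (B `&` allowed R L)) / fine (vol (allowed R L)))%:E.

(* Probability measures on Omega are encoded as probability measures on R^L
   giving mass 1 to Omega, whence the restriction of the preimages to Omega. *)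
Definition invariant_probability a nu : Prop :=
  nu (Omega R L) = 1%E /\
  forall B, measurable B -> B `<=` Omega R L ->
    nu B = ((#|{: L}|%:R^-1)%:E *
            \sum_(x : L) nu (Omega R L `&` add_op a x @^-1` B))%E.

(* Only the values of g on allowed configurations matter. *)
Definition invariant_function a nu (g : config R L -> R) : Prop :=
  [/\ measurable_fun (allowed R L) g,
      (exists M : R, forall eta, allowed R L eta -> `|g eta| <= M) &
      {ae nu, forall eta, allowed R L eta ->
         #|{: L}|%:R^-1 * (\sum_(x : L) g (add_op a x eta)) = g eta}].

Definition ergodic a nu : Prop :=
  [/\ invariant_probability a nu,
      nu (allowed R L) = 1%E &
      forall g, invariant_function a nu g ->
        exists c : R, {ae nu, forall eta, allowed R L eta -> g eta = c}].

End InvariantMeasures.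

(* Main.v *)
From HB Require Import structures.
Require Import Defs.
From mathcomp Require Import all_boot all_order all_algebra finmap ring lra zify.
From mathcomp Require Import all_classical all_reals all_analysis measurable_realfun.

(** Modulo the lattice generated by the rows of [Delta], [add_op a x] is the
    translation by [a] at site [x], and the allowed configurations form a
    fundamental domain.  So [add_op a x] is injective on allowed configurations
    and piecewise a translation, hence preserves their volume.  An invariant
    measure [nu] lives on allowed configurations, because enough additions at
    each site make every site topple.  For a lattice-periodic set [E] the
    function [g |-> nu (E - g)] is harmonic for the random walk with steps [a] at
    a uniform site; since [a] is irrational and the lattice contains [D Z^L] for
    some integer [D > 0], this walk is uniformly dense modulo the lattice.  Near
    its supremum the function is therefore nearly constant, up to thickening [E]
    slightly.  Integrating it against a second invariant measure [mu] with Tonelli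
    compares [nu E] with [mu E], whence uniqueness.  For ergodicity, an [L^2]
    computation shows that an invariant function is constant along every
    [add_op a x]; its level sets then carry conditional measures which are again
    invariant, so by uniqueness they have measure 0 or 1. *)

Set Implicit Arguments.
Unset Strict Implicit.
Unset Printing Implicit Defensive.

Import Order.TTheory GRing.Theory Num.Theory.
Local Open Scope classical_set_scope.
Local Open Scope ring_scope.

(** The random walk reaches a target shift only approximately, and indicator functions are not
    continuous. This is why the compared sets carry a slack [e], which loosens both the height
    bounds and the absence of forbidden sub-configurations: a displacement of size [delta] modulo
    the lattice costs at most [delta] of slack. Exact information returns only when the slack tends
    to 0; the strict inequalities below height 1 then leave the room that makes the lattice
    representative unique.

    A single function controls the finite geometry: a positive [w] on [L] with [lap w >= 1]. It
    bounds the number of topplings, makes the Laplacian injective (hence the integer period [D]),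
    and yields in every nonempty set of sites one with fewer than 2d neighbours in the set, so that
    the allowed configurations have positive volume. *)

Lemma int_sqr_sum_eq1 (d : nat) (z : 'I_d -> int) :
  \sum_(i < d) z i ^+ 2 = 1 ->
  exists k : 'I_d * bool, forall i, z i = (-1) ^+ k.2 * (i == k.1)%:R.
Proof.
move=> z1; have [i zi0] : exists i, z i != 0.
  apply/existsP; apply: contra_eqT z1 => /existsPn z0.
  rewrite big1 // => i _; by move: (z0 i); rewrite negbK => /eqP->; rewrite expr0n.
move: z1; rewrite (bigD1 i)//=; set s := \sum_(_ | _) _ => z1.
have s0 : 0 <= s by apply: sumr_ge0 => j _; exact: sqr_ge0.
have zi1 : 1 <= z i ^+ 2 by rewrite -gtz0_ge1 exprn_even_gt0.
have sE : s = 0 by apply/eqP; rewrite eq_le s0 andbT; lia.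
have /eqP : z i ^+ 2 = 1 by rewrite sE addr0 in z1.
rewrite sqrf_eq1 => zi; exists (i, z i == -1) => j /=.
have [->|ji] := eqVneq j i.
  by rewrite mulr1; case/orP: zi => /eqP ->.
rewrite mulr0; move/eqP: sE; rewrite psumr_eq0 => [|k _]; last exact: sqr_ge0.
by move/allP => /(_ j (mem_index_enum _)); rewrite ji/= sqrf_eq0 => /eqP.
Qed.

(** * The graph Laplacian of a finite set of sites *)

Section Lattice.
Context (R : realType) (d : nat) (L : {fset 'rV[int]_d}).
Hypothesis d_ge1 : (1 <= d)%N.
Implicit Types (eta zeta : config R L) (x y : L) (W U : {set L}) (s : seq L).

Local Notation nbr := (neighbour R).
Local Notation c2d := ((2 * d)%:R^-1 : R).

Let d2_gt0 : 0 < (2 * d)%:R :> R.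
Proof. by rewrite ltr0n; case: d d_ge1. Qed.

Lemma inv2d_gt0 : 0 < c2d. Proof. by rewrite invr_gt0. Qed.

Lemma neighbourC x y : nbr x y = nbr y x.
Proof.
rewrite /neighbour /euclidean_dist; congr (Num.sqrt _ == _).
by apply: eq_bigr => i _; rewrite -sqrrN -rmorphN opprB.
Qed.

Lemma neighbourxx x : nbr x x = false.
Proof.
rewrite /neighbour /euclidean_dist big1 ?sqrtr0 1?eq_sym ?oner_eq0//.
by move=> i _; rewrite subrr expr0n.
Qed.

Lemma neighbourE x y : nbr x y ->
  exists k : 'I_d * bool, val y = val x + (-1) ^+ k.2 *: 'e_k.1.
Proof.
rewrite /neighbour /euclidean_dist => /eqP /(congr1 (fun r => r ^+ 2)).
rewrite sqr_sqrtr; last by apply: sumr_ge0 => i _; exact: sqr_ge0.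
rewrite expr1n (_ : \sum_(i < d) _ =
    (\sum_(i < d) (val y ord0 i - val x ord0 i) ^+ 2)%:~R); last first.
  rewrite rmorph_sum; apply: eq_bigr => i _.
  by rewrite rmorphXn -sqrrN -rmorphN opprB.
move=> /(@intr_inj R _ 1) /int_sqr_sum_eq1 [k zk]; exists k.
apply/rowP => i; rewrite !mxE /= -zk; by rewrite addrC subrK.
Qed.

(** Distinct neighbours lie in distinct directions, so the sum over [L] is part of the sum over all
    2d directions; directions leaving [L] contribute nonnegative terms. This reduces estimates on
    [L] to computations in the full lattice. *)
Lemma sum_neighbour_le x (f : 'rV[int]_d -> R) :
  (forall k : 'I_d * bool, 0 <= f (val x + (-1) ^+ k.2 *: 'e_k.1)) ->
  \sum_(y | nbr x y) f (val y) <=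
  \sum_(k : 'I_d * bool) f (val x + (-1) ^+ k.2 *: 'e_k.1).
Proof.
move=> f0.
have /choice [h hP] : forall y, exists k : 'I_d * bool,
    nbr x y -> val y = val x + (-1) ^+ k.2 *: 'e_k.1.
  move=> y; have [/neighbourE[k ->]|] := boolP (nbr x y); first by exists k.
  by move=> _; exists (Ordinal d_ge1, true).
have hI : {in [set y | nbr x y]%SET &, injective h}.
  move=> y z; rewrite !inE => xy xz hyz; apply: val_inj.
  by rewrite (hP _ xy) hyz -hP.
rewrite [leRHS](bigID (mem (h @: [set y | nbr x y]%SET)))/=.
rewrite big_imset//= ler_wpDr ?sumr_ge0//.
rewrite [leRHS](eq_bigl (fun y => nbr x y)) => [|y]; last by rewrite inE.
by apply: ler_sum => y xy; rewrite -hP.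
Qed.

Definition degree W x : nat := #|[set y in W | nbr x y]%SET|.

Lemma degreeE W x : (degree W x)%:R = \sum_(y | nbr x y) (y \in W)%:R :> R.
Proof.
rewrite /degree -sum1_card natr_sum big_mkcond [RHS]big_mkcond/=.
by apply: eq_bigr => y _; rewrite inE; case: (y \in W); case: nbr.
Qed.

Lemma degree_setT x : c2d * (degree finset.setT x)%:R <= 1.
Proof.
rewrite mulrC ler_pdivrMr// mul1r degreeE.
rewrite (eq_bigr (fun y => 1)) => [|y _]; last by rewrite inE.
apply: le_trans (@sum_neighbour_le x (fun=> 1) _) _ => //.
by rewrite sumr_const card_prod card_ord card_bool mulnC.
Qed.

(** As [Delta] is symmetric, this is its action on functions from either side: the effect of [v]
    topplings as well as the pairing of a weight with a row. *)
Definition lap (v : L -> R) x : R := v x - c2d * \sum_(y | nbr x y) v y.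

Lemma lapB v v' x : lap (fun y => v y - v' y) x = lap v x - lap v' x.
Proof. by rewrite /lap sumrB; ring. Qed.

Lemma lapD v v' x : lap (fun y => v y + v' y) x = lap v x + lap v' x.
Proof. by rewrite /lap big_split/=; ring. Qed.

Lemma lapN v x : lap (fun y => - v y) x = - lap v x.
Proof. by rewrite /lap sumrN; ring. Qed.

Lemma lap_sum (I : finType) (f : I -> L -> R) x :
  lap (fun y => \sum_i f i y) x = \sum_i lap (f i) x.
Proof. by rewrite /lap exchange_big mulr_sumr -sumrB. Qed.

Lemma lapZ (r : R) v x : lap (fun y => r * v y) x = r * lap v x.
Proof. by rewrite /lap -mulr_sumr; ring. Qed.

Lemma lap0 x : lap (fun=> 0) x = 0.
Proof. by rewrite /lap big1 // mulr0 subrr. Qed.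

(* The witness is [w x = C - |x|^2] with [C] large. *)
Lemma lap_superharmonic :
  exists w : L -> R, (forall x, 0 < w x) /\ (forall x, 1 <= lap w x).
Proof.
pose q (p : 'rV[int]_d) : R := \sum_(i < d) (p ord0 i)%:~R ^+ 2.
have q_ge0 p : 0 <= q p by apply: sumr_ge0 => i _; exact: sqr_ge0.
have qD p (k : 'I_d * bool) : q (p + (-1) ^+ k.2 *: 'e_k.1) =
    q p + 1 + 2 * (-1) ^+ k.2 * (p ord0 k.1)%:~R.
  rewrite /q (bigD1 k.1)//= [in RHS](bigD1 k.1)//=.
  rewrite (eq_bigr (fun i => (p ord0 i)%:~R ^+ 2)) => [|i ik]; last first.
    by rewrite !mxE eqxx (negbTE ik) mulr0 addr0.
  rewrite !mxE !eqxx mulr1 rmorphD/= rmorphXn/= rmorphN1.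
  by case: (k.2); rewrite /= ?expr1 ?expr0; ring.
have qD_le p (k : 'I_d * bool) : q (p + (-1) ^+ k.2 *: 'e_k.1) <= 2 * q p + 2.
  rewrite qD; have : (p ord0 k.1)%:~R ^+ 2 <= q p :> R.
    by rewrite /q (bigD1 k.1)//= lerDl sumr_ge0// => i _; exact: sqr_ge0.
  have := sqr_ge0 ((p ord0 k.1)%:~R - (-1) ^+ k.2 : R).
  by case: (k.2); rewrite /= ?expr1 ?expr0; lra.
(* By [qD_le], this [C] also dominates [q] at the lattice neighbours outside [L], as
   [sum_neighbour_le] requires. *)
pose C := 1 + \sum_(x : L) (2 * q (val x) + 2).
have qC x : 1 + (2 * q (val x) + 2) <= C.
  rewrite /C lerD2l (bigD1 x)//= lerDl sumr_ge0// => y _.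
  by have := q_ge0 (val y); lra.
exists (fun x => C - q (val x)); split=> x.
  by have := qC x; have := q_ge0 (val x); lra.
rewrite /lap.
have := @sum_neighbour_le x (fun p => C - q p).
set S := \sum_(_ | _) _.
(* The terms linear in the position cancel between opposite directions, and each direction adds 1 to
   the squared norm. *)
have -> : \sum_(k : 'I_d * bool) (C - q (val x + (-1) ^+ k.2 *: 'e_k.1)) =
    (2 * d)%:R * (C - q (val x) - 1).
  rewrite -(pair_big xpredT xpredT
    (fun i b => C - q (val x + (-1) ^+ (b : bool) *: 'e_i)))/=.
  rewrite (eq_bigr (fun i => (C - q (val x) - 1) *+ 2)).
    by rewrite sumr_const card_ord -mulrnA [in RHS]mulr_natl.
  move=> i _; rewrite big_bool (qD _ (i, true)) (qD _ (i, false))/= expr1 expr0.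
  by rewrite mulr2n; ring.
move=> /(_ _)/wrap[]; first by move=> k; have := qD_le (val x) k; have := qC x; lra.
rewrite -ler_pdivrMl// => ?; lra.
Qed.

Definition translate (t : L -> R) eta : config R L :=
  mkconfig (fun y => height eta y + t y).

Lemma height_mkconfig (f : L -> R) x : height (mkconfig f) x = f x.
Proof. by rewrite /height tnth_mktuple enum_rankK. Qed.

Lemma height_translate t eta x : height (translate t eta) x = height eta x + t x.
Proof. exact: height_mkconfig. Qed.

Lemma height_inj eta zeta : height eta =1 height zeta -> eta = zeta.
Proof.
move=> h; apply: eq_from_tnth => i.
by have := h (enum_val i); rewrite /height enum_valK.
Qed.

Lemma translateD t u eta : translate t (translate u eta) = translate (fun x => t x + u x) eta.
Proof. by apply: height_inj => x; rewrite !height_translate; ring. Qed.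

Lemma translate0 t eta : t =1 (fun=> 0) -> translate t eta = eta.
Proof. by move=> t0; apply: height_inj => x; rewrite height_translate t0 addr0. Qed.

Lemma eq_translate t u eta : t =1 u -> translate t eta = translate u eta.
Proof. by move=> tu; apply: height_inj => x; rewrite !height_translate tu. Qed.

Definition odometer s : L -> R := fun x => (count_mem x s)%:R.

(** Each toppling subtracts one row of [Delta], so a run depends on its word only through the number
    of topplings per site, legal or not. *)
Lemma foldl_topple eta s :
  foldl (@topple R d L) eta s = translate (fun x => - lap (odometer s) x) eta.
Proof.
elim: s eta => [|x s IH] eta /=.
  by rewrite translate0// => x; rewrite lap0 oppr0.
rewrite IH; apply: height_inj => y; rewrite !height_translate height_mkconfig.
rewrite -addrA -opprD; congr (_ - _).
rewrite /odometer /=; under [in RHS]eq_fun do rewrite natrD.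
rewrite lapD; congr (_ + _).
rewrite /Delta /lap; have [<-|xy] := eqVneq x y.
  rewrite big1 ?mulr0 ?subr0// => z xz.
  by case: eqVneq xz => //= <-; rewrite neighbourxx.
rewrite sub0r neighbourC; have [yx|/negbTE yx] := boolP (nbr y x).
  rewrite (bigD1 x)//= eqxx big1 ?addr0 ?mulr1// => z /andP[_ zx].
  by rewrite eq_sym (negbTE zx).
rewrite big1 ?mulr0 ?oppr0// => z yz.
by case: eqVneq yz => //= <-; rewrite yx.
Qed.

End Lattice.

(** * Topplings and forbidden sub-configurations *)

Section Dynamics.
Context (R : realType) (d : nat) (L : {fset 'rV[int]_d}).
Hypothesis d_ge1 : (1 <= d)%N.
Implicit Types (eta zeta : config R L) (x y : L) (W U : {set L}) (s : seq L).

Local Notation nbr := (neighbour R).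
Local Notation c2d := ((2 * d)%:R^-1 : R).
Local Notation run := (foldl (@topple R d L)).

(* No nonempty subset of [U] carries a forbidden sub-configuration, up to a
   slack [e]; [e > 0] is used to thicken sets of allowed configurations. *)
Definition unforbidden (e : R) U eta := forall W, W != finset.set0 ->
  W \subset U -> exists2 x, x \in W & c2d * (degree R W x)%:R - e <= height eta x.

Lemma allowedE eta :
  allowed R L eta <-> Omega R L eta /\ unforbidden 0 finset.setT eta.
Proof.
split=> -[Oeta H]; split=> //; [move=> W W0 _|move=> [W [W0 fW]]].
  apply: contra_notP H => H; exists W; split=> // x xW.
  by rewrite ltNge; apply/negP => ?; apply: H; exists x; rewrite ?subr0.
have [x xW] := H W W0 (finset.subsetT _).
by rewrite subr0 leNgt fW.
Qed.

Lemma unforbiddenW e U eta zeta : (forall x, height eta x <= height zeta x) ->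
  unforbidden e U eta -> unforbidden e U zeta.
Proof.
by move=> le H W W0 WU; have [x xW Hx] := H W W0 WU; exists x => //; exact: le_trans Hx _.
Qed.

Lemma unforbiddenS e U U' eta : U' \subset U ->
  unforbidden e U eta -> unforbidden e U' eta.
Proof. by move=> UU H W W0 WU; apply: H => //; exact: fintype.subset_trans UU. Qed.

Lemma height_topple eta x y : height (topple eta x) y =
  if y == x then height eta y - 1 else
    height eta y + if nbr x y then c2d else 0.
Proof.
rewrite height_mkconfig /Delta (eq_sym x).
by case: eqVneq => //= _; case: ifP => _; rewrite ?opprK// oppr0.
Qed.

(** For [W] containing [x], take the site [y] provided by [W] without [x]: if [y] is a neighbour of
    [x], its degree grows by one and the toppling has just given it the matching 1/(2d). If [W] is
    reduced to [x], its degree is 0 and the height of [x] is still nonnegative. *)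
Lemma unforbidden_topple U eta x : 1 <= height eta x ->
  unforbidden 0 U eta -> unforbidden 0 (x |: U)%SET (topple eta x).
Proof.
move=> x1 H W W0 WU.
have c0 := inv2d_gt0 R d_ge1.
have [xW|xW] := boolP (x \in W); last first.
  have WU' : W \subset U.
    apply/fintype.subsetP => y yW; have := fintype.subsetP WU _ yW.
    by rewrite !inE => /predU1P[yx|//]; rewrite yx (negbTE xW) in yW.
  have [y yW Hy] := H W W0 WU'; exists y => //; apply: le_trans Hy _.
  rewrite height_topple; case: eqVneq => [yx|_]; first by rewrite yx (negbTE xW) in yW.
  by case: ifP => _; lra.
have [Wx0|Wx0] := eqVneq (W :\ x)%SET finset.set0.
  exists x => //; rewrite height_topple eqxx /degree.
  rewrite (_ : [set y in W | nbr x y]%SET = finset.set0) ?cards0 ?mulr0; first lra.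
  apply/setP => y; rewrite !inE; case: (eqVneq y x) => [->|yx].
    by rewrite neighbourxx andbF.
  by move/setP: Wx0 => /(_ y); rewrite !inE yx/= => ->.
have [y] : exists2 y, y \in (W :\ x)%SET &
    c2d * (degree R (W :\ x)%SET y)%:R - 0 <= height eta y.
  apply: H => //; apply/fintype.subsetP => y; rewrite !inE => /andP[yx yW].
  by have := fintype.subsetP WU _ yW; rewrite !inE (negbTE yx).
rewrite !inE => /andP[yx yW] Hy; exists y => //.
rewrite height_topple (negbTE yx).
have -> : (degree R W y)%:R = (degree R (W :\ x)%SET y)%:R + (nbr x y)%:R :> R.
  rewrite -natrD; congr (_%:R); rewrite /degree (cardsD1 x) !inE xW/= addnC.
  rewrite (neighbourC R y x); congr (_ + _)%N; apply: eq_card => z; rewrite !inE.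
  by rewrite andbA.
by case: (nbr x y); rewrite /= ?mulrDr ?mulr1 ?mulr0; lra.
Qed.

Lemma unforbidden_run U eta s : legal eta s -> unforbidden 0 U eta ->
  unforbidden 0 (U :|: [set x in s])%SET (run eta s).
Proof.
elim: s U eta => [|x s IH] U eta /=.
  by move=> _; apply: unforbiddenS; apply/fintype.subsetP => y; rewrite !inE orbF.
move=> [x1 ls] H; apply: unforbiddenS (IH _ _ ls (unforbidden_topple x1 H)).
by apply/fintype.subsetP => y; rewrite !inE; case/or3P => ->; rewrite ?orbT.
Qed.

Lemma height_run_ge0 eta s : legal eta s -> (forall x, 0 <= height eta x) ->
  forall x, 0 <= height (run eta s) x.
Proof.
elim: s eta => //= x s IH eta [x1 ls] H; apply: IH => // y.
rewrite height_topple; have := inv2d_gt0 R d_ge1; have := H y.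
by case: eqVneq => [->|_]; [lra|case: ifP => _; lra].
Qed.

Lemma height_run_notin eta s y : y \notin s -> height eta y <= height (run eta s) y.
Proof.
elim: s eta => //= x s IH eta; rewrite inE negb_or => /andP[yx ys].
apply: le_trans (IH _ ys); rewrite height_topple (negbTE yx).
by have := inv2d_gt0 R d_ge1; case: ifP => _; lra.
Qed.

Lemma sum_Delta (w : L -> R) x : \sum_y w y * Delta R x y = lap w x.
Proof.
rewrite (bigD1 x)//= /Delta eqxx mulr1 /lap; congr (_ + _).
rewrite mulr_sumr -sumrN big_mkcond [RHS]big_mkcond/=.
apply: eq_bigr => y _; rewrite (eq_sym x); case: eqVneq => [->|_] /=.
  by rewrite neighbourxx.
by case: ifP => _; rewrite ?mulr0// mulrN mulrC.
Qed.

(** The weighted mass [\sum_x w x * height eta x] is nonnegative and drops by [lap w x >= 1] when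
    [x] topples; the induction is on an integer bound for it. *)
Lemma stabilization_exists eta : (forall x, 0 <= height eta x) ->
  exists2 s, legal eta s & Omega R L (run eta s).
Proof.
have [w [w0 w1]] := @lap_superharmonic R d L d_ge1.
have [n] : exists n : nat, \sum_x w x * height eta x <= n%:R.
  exists (Num.truncn (\sum_x w x * height eta x)).+1.
  by rewrite ltW// truncnS_gt.
elim: n eta => [|n IH] eta En eta0.
  exists [::] => //= x; rewrite eta0/=.
  suff -> : height eta x = 0 by [].
  apply/eqP; rewrite eq_le eta0 andbT.
  have : w x * height eta x <= 0.
    apply: le_trans En; rewrite (bigD1 x)//= lerDl sumr_ge0// => y _.
    by rewrite mulr_ge0// ltW.
  by rewrite pmulr_rle0.
have [[x x1]|H] := pselect (exists x, 1 <= height eta x); last first.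
  exists [::] => //= x; rewrite eta0/= ltNge; apply/negP => ?.
  by apply: H; exists x.
have t0 : legal eta [:: x] by [].
have [||s ls Os] := IH (topple eta x).
- rewrite (eq_bigr (fun y => w y * height eta y - w y * Delta R x y)).
    by rewrite sumrB sum_Delta; have := w1 x; move: En; rewrite -natr1; lra.
  by move=> y _; rewrite height_mkconfig mulrBr.
- exact: (height_run_ge0 t0).
- by exists (x :: s).
Qed.

Lemma legal_rcons eta s x :
  legal eta (rcons s x) <-> legal eta s /\ 1 <= height (run eta s) x.
Proof.
by elim: s eta => [|y s IH] eta /=; [tauto|rewrite IH; tauto].
Qed.

(** Consider a last toppling, at [x], that would exceed [k]. Just before it, [x] has toppled exactly
    [k x] times and no other site more than [k] allows, so [x] is at most as high as after [k],
    hence below 1, and the toppling is not legal. *)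
Lemma least_action eta s (k : L -> nat) : legal eta s ->
  (forall x, height (translate (fun y => - lap (fun z => (k z)%:R) y) eta) x < 1) ->
  forall x, (count_mem x s <= k x)%N.
Proof.
move=> + k1; elim/last_ind: s => [//|s x IH] /legal_rcons[/IH les x1] y.
rewrite -cats1 count_cat/= addn0; have [<-{y}|xy] := eqVneq x y; last by rewrite addn0.
rewrite addn1 ltn_neqAle les andbT; apply/eqP => xE.
have := k1 x; rewrite ltNge => /negP; apply; apply: le_trans x1 _.
rewrite foldl_topple !height_translate lerD2l lerN2 /lap /odometer xE lerD2l lerN2.
by rewrite ler_pM2l ?inv2d_gt0//; apply: ler_sum => z _; rewrite ler_nat.
Qed.

Lemma stabilizations_unique eta zeta zeta' :
  stabilizations eta zeta -> stabilizations eta zeta' -> zeta = zeta'.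
Proof.
move=> [Oz [s [ls zE]]]; move: Oz; rewrite {}zE foldl_topple => Oz.
move=> [Oz' [s' [ls' zE']]]; move: Oz'; rewrite {}zE' foldl_topple => Oz'.
suff -> : odometer R s = odometer R s' by [].
apply/funext => x; congr (_%:R); apply/eqP; rewrite eqn_leq.
rewrite (@least_action eta s (fun x => count_mem x s'))//=; last first.
  by move=> y; have /andP[] := Oz' y.
rewrite (@least_action eta s' (fun x => count_mem x s))//=.
by move=> y; have /andP[] := Oz y.
Qed.

Definition deposit (u : R) x : L -> R := fun y => u * (y == x)%:R.

Lemma add_opE u x eta zeta : stabilizations (translate (deposit u x) eta) zeta ->
  add_op u x eta = zeta.
Proof.
move=> H; rewrite /add_op /stabilize; case: xgetP => [xi _ Hxi|/(_ zeta)//].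
exact: stabilizations_unique Hxi H.
Qed.

Lemma add_opP u x eta : 0 <= u -> Omega R L eta ->
  exists s, [/\ legal (translate (deposit u x) eta) s,
    add_op u x eta = run (translate (deposit u x) eta) s & Omega R L (add_op u x eta)].
Proof.
move=> u0 Oe.
have [|s ls Os] := @stabilization_exists (translate (deposit u x) eta).
  move=> y; rewrite height_translate /deposit addr_ge0//; first by have /andP[] := Oe y.
  by rewrite mulr_ge0.
have H : add_op u x eta = run (translate (deposit u x) eta) s.
  by apply: add_opE; split=> //; exists s.
by exists s; rewrite H.
Qed.

Lemma height_deposit_le u x eta y : 0 <= u -> height eta y <= height (translate (deposit u x) eta) y.
Proof. by move=> u0; rewrite height_translate lerDl mulr_ge0. Qed.

Lemma unforbidden_add_op U u x eta : 0 <= u -> Omega R L eta ->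
  unforbidden 0 U eta -> unforbidden 0 U (add_op u x eta).
Proof.
move=> u0 Oe H; have [s [ls -> _]] := add_opP x u0 Oe.
apply: unforbiddenS (unforbidden_run ls (unforbiddenW _ H)).
  exact: finset.subsetUl.
by move=> y; exact: height_deposit_le.
Qed.

Lemma allowed_add_op u x eta : 0 <= u -> allowed R L eta ->
  allowed R L (add_op u x eta).
Proof.
move=> u0 /allowedE[Oe H]; apply/allowedE; split; last exact: unforbidden_add_op.
by have [s []] := add_opP x u0 Oe.
Qed.

Local Notation ilap v := (lap (fun z => (v z : int)%:~R : R)).

(** [W] is the set where [v] attains its maximum m, which is at least 1. Elsewhere the integer [v]
    is at most m - 1, and a site has at most 2d neighbours, so each site of [W] loses at least 1
    minus 1/(2d) times its degree in [W]. If [eta] is below 1, [W] is thus forbidden in [zeta]. *)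
Lemma translate_argmax (v : L -> int) eta zeta x0 :
  zeta = translate (fun y => - ilap v y) eta -> 0 < v x0 ->
  exists2 W, W != finset.set0 & forall x, x \in W ->
    height zeta x <= height eta x - 1 + c2d * (degree R W x)%:R.
Proof.
move=> -> vx0; pose m := v [arg max_(x > x0) v x]%O.
have vm x : v x <= m by rewrite /m; case: arg_maxP => // i _; exact.
have m0 : 1 <= m by rewrite (le_trans _ (vm x0)).
exists [set x | v x == m]%SET.
  by apply/set0Pn; exists [arg max_(x > x0) v x]%O; rewrite inE.
move=> x; set W := finset _; rewrite inE => /eqP vx.
rewrite height_translate /lap vx -addrA lerD2l opprB lerBlDr -addrA.
have : \sum_(y | nbr x y) (v y)%:~R <=
    (m%:~R - 1) * (degree R finset.setT x)%:R + (degree R W x)%:R :> R.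
  rewrite !degreeE mulr_sumr -big_split/=; apply: ler_sum => y _; rewrite !inE mulr1.
  have [->|vy] := eqVneq (v y) m; first by rewrite subrK.
  by rewrite addr0 -[1](mulr1z 1) -rmorphB/= ler_int lerBrDr lezD1 lt_neqAle vy vm.
move=> /(ler_wpM2l (ltW (inv2d_gt0 R d_ge1))) le_sum.
have m1 : 0 <= m%:~R - 1 :> R by rewrite subr_ge0 -[1]/(1%:~R) ler_int.
apply: le_trans le_sum _.
have := ler_wpM2l m1 (@degree_setT R d L d_ge1 x); lra.
Qed.

Lemma unforbidden_le0 e (v : L -> int) eta zeta :
  zeta = translate (fun y => - ilap v y) eta -> unforbidden e finset.setT zeta ->
  (forall x, height eta x < 1 - e) -> forall x, v x <= 0.
Proof.
move=> E H eta1 x0; rewrite leNgt; apply/negP => vx0.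
have [W W0 WP] := translate_argmax E vx0.
have [x xW Hx] := H W W0 (finset.subsetT _).
by have := WP _ xW; have := eta1 x; lra.
Qed.

(** Applying [unforbidden_le0] to [v] and to its opposite gives [v = 0]. The slack of [zeta] is
    absorbed by room below height 1 in [eta]; since [eta] has no slack, [zeta] need only be below 1.
    The case [e = 0] separates allowed configurations modulo the lattice, and [e > 0] serves the
    thickened sets. *)
Lemma unforbidden_eq e (v : L -> int) eta zeta :
  zeta = translate (fun y => - ilap v y) eta -> unforbidden e finset.setT zeta ->
  (forall x, height eta x < 1 - e) -> unforbidden 0 finset.setT eta ->
  (forall x, height zeta x < 1) -> zeta = eta.
Proof.
move=> E Hz eta1 He zeta1.
have v0 := unforbidden_le0 E Hz eta1.
have E' : eta = translate (fun y => - ilap (fun x => - v x) y) zeta.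
  apply: height_inj => y; rewrite E !height_translate.
  by under [in X in _ - X]eq_fun do rewrite rmorphN; rewrite lapN; ring.
have Nv0 : forall x, - v x <= 0.
  by apply: (unforbidden_le0 E' He) => x; rewrite subr0.
rewrite E translate0// => x; under eq_fun => z.
  by rewrite (_ : v z = 0); [over|apply/eqP; rewrite eq_le v0 -oppr_le0 Nv0].
by rewrite lap0 oppr0.
Qed.

Lemma allowed_unique (v : L -> int) eta zeta :
  zeta = translate (fun y => - ilap v y) eta ->
  allowed R L eta -> allowed R L zeta -> zeta = eta.
Proof.
move=> E /allowedE[Oe He] /allowedE[Oz Hz].
apply: (unforbidden_eq E Hz) => // x; last by have /andP[] := Oz x.
by rewrite subr0; have /andP[] := Oe x.
Qed.

Lemma add_op_translate u x eta : 0 <= u -> Omega R L eta ->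
  exists v : L -> int,
    add_op u x eta = translate (fun y => deposit u x y - ilap v y) eta.
Proof.
move=> u0 Oe; have [s [_ -> _]] := add_opP x u0 Oe.
exists (fun x => (count_mem x s)%:Z); rewrite foldl_topple translateD.
by apply: eq_translate => y; rewrite addrC.
Qed.

Lemma add_op_inj u x eta zeta : 0 <= u -> allowed R L eta -> allowed R L zeta ->
  add_op u x eta = add_op u x zeta -> eta = zeta.
Proof.
move=> u0 Ae Az; have [Oe _] := Ae; have [Oz _] := Az.
have [v ->] := add_op_translate x u0 Oe; have [v' ->] := add_op_translate x u0 Oz.
move=> E; apply: (@allowed_unique (fun x => v' x - v x)) => //.
apply: height_inj => y; have := congr1 (fun t => height t y) E.
rewrite !height_translate.
under [X in _ -> _ = _ + - lap X _]eq_fun do rewrite rmorphB.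
by rewrite lapB; lra.
Qed.

(** Maximum principle relative to [w]: where [u / w] attains a maximum t > 0, the nonnegative
    function [t * w - u] vanishes, so its Laplacian there is at most 0; but it equals [t * lap w],
    which is positive. *)
Lemma lap_le0 (u : L -> R) : (forall x, lap u x = 0) -> forall x, u x <= 0.
Proof.
have [w [w0 w1]] := @lap_superharmonic R d L d_ge1.
move=> lu x1; rewrite leNgt; apply/negP => ux1.
pose x0 := [arg max_(x > x1) (u x / w x)]%O.
have um x : u x / w x <= u x0 / w x0 by rewrite /x0; case: arg_maxP => // i _; exact.
set t := u x0 / w x0 in um.
have t0 : 0 < t by apply: lt_le_trans (um x1); rewrite divr_gt0.
have : 0 < t * lap w x0 by rewrite mulr_gt0// (lt_le_trans _ (w1 x0)).
have -> : t * lap w x0 = lap (fun x => t * w x - u x) x0.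
  by rewrite lapB lu subr0 /lap -mulr_sumr; ring.
rewrite /lap {1}/t divfK ?gt_eqF// subrr sub0r oppr_gt0 ltNge mulr_ge0//.
by apply: sumr_ge0 => y _; rewrite subr_ge0 -ler_pdivrMr.
Qed.

Lemma lap_eq0 (u : L -> R) : (forall x, lap u x = 0) -> forall x, u x = 0.
Proof.
move=> lu x; apply/eqP; rewrite eq_le lap_le0//= -oppr_le0.
by apply: (@lap_le0 (fun x => - u x)) => y; rewrite lapN lu oppr0.
Qed.

(* The adjugate of the integer matrix [2 d Delta] inverts it up to [D]. *)
Lemma lattice_period : exists2 D : nat, (0 < D)%N &
  forall x, exists v : L -> int, forall y, ilap v y = D%:R * (y == x)%:R.
Proof.
pose n := #|{: L}|.
pose M : 'M[int]_n := \matrix_(i, j)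
  if i == j then (2 * d)%:Z else if nbr (enum_val i) (enum_val j) then -1 else 0.
have ME x y : (M (enum_rank x) (enum_rank y))%:~R = (2 * d)%:R * Delta R x y.
  have d0 : (2 * d)%:R != 0 :> R by rewrite -invr_eq0 gt_eqF// inv2d_gt0.
  rewrite mxE !enum_rankK (inj_eq enum_rank_inj) /Delta.
  case: eqVneq => _; first by rewrite mulr1.
  by case: ifP => _; rewrite ?mulr0// mulrN divff.
have lapM (f : 'I_n -> R) y : \sum_j f j * (M j (enum_rank y))%:~R =
    (2 * d)%:R * lap (f \o enum_rank) y.
  rewrite (reindex_onto (@enum_rank L) enum_val)/=; last by move=> *; exact: enum_valK.
  rewrite -sum_Delta mulr_sumr; apply: eq_big => z; first by rewrite enum_rankK eqxx.
  move=> _; rewrite ME /Delta (eq_sym z) (neighbourC R z) /=; ring.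
have detM : \det M != 0.
  rewrite -(intr_eq0 R) -det_map_mx; apply/det0P => -[u u0 uM].
  case/eqP: u0; apply/rowP => i; rewrite mxE.
  have := @lap_eq0 (fun x => u ord0 (enum_rank x)) _ (enum_val i).
  rewrite enum_valK; apply => y.
  have /rowP/(_ (enum_rank y)) := uM; rewrite !mxE => H.
  apply/eqP; have : (2 * d)%:R * lap (u ord0 \o enum_rank) y == 0.
    by rewrite -lapM; apply/eqP; rewrite -[RHS]H; apply: eq_bigr => j _; rewrite !mxE.
  rewrite mulf_eq0 => /orP[|//]; by rewrite -invr_eq0 gt_eqF// inv2d_gt0.
exists (absz (\det M)); first by rewrite absz_gt0.
(* The factor [2 * d] compensates for [M] being [2 * d] times [Delta], and the sign turns the
   determinant into its absolute value. *)
move=> x; exists (fun y => Num.sg (\det M) * (2 * d)%:Z * (\adj M) (enum_rank x) (enum_rank y)) => y.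
have /matrixP/(_ (enum_rank x) (enum_rank y)) := mul_adj_mx M.
rewrite !mxE => H.
have := lapM (fun j => (\adj M (enum_rank x) j)%:~R) y.
under eq_bigr do rewrite -rmorphM.
rewrite -rmorph_sum H (inj_eq enum_rank_inj) /= => H'.
rewrite (_ : lap _ _ = (Num.sg (\det M))%:~R * ((2 * d)%:R *
  lap ((fun j => (\adj M (enum_rank x) j)%:~R) \o enum_rank) y)).
  rewrite -H' (eq_sym y) natr_absz normrEsg rmorphM/=.
  by case: eqP => _; rewrite ?mulr1n ?mulr0n ?mulr1 ?mulr0// rmorph0 mulr0.
rewrite /lap /= !rmorphM /=.
under eq_bigr do rewrite !rmorphM.
rewrite -mulr_sumr; ring.
Qed.

End Dynamics.

(** * Measurability *)

Lemma measurable_exists_fin (T : finType) (disp : measure_display)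
    (X : measurableType disp) (P : T -> set X) :
  (forall t, measurable (P t)) -> measurable [set x | exists t, P t x].
Proof.
move=> mP; rewrite (_ : [set _ | _] = \bigcup_(t in setT) P t).
  by apply: fin_bigcup_measurable.
by apply/seteqP; split=> x [t] => [Px|_ Px]; exists t.
Qed.

Lemma measurable_forall_fin (T : finType) (disp : measure_display)
    (X : measurableType disp) (P : T -> set X) :
  (forall t, measurable (P t)) -> measurable [set x | forall t, P t x].
Proof.
move=> mP; rewrite (_ : [set _ | _] = \bigcap_(t in setT) P t).
  by apply: fin_bigcap_measurable.
by apply/seteqP; split=> x H t => [_|]; exact: H.
Qed.

Lemma measurable_exists_countable (T : countType) (disp : measure_display)
    (X : measurableType disp) (P : T -> set X) :
  (forall t, measurable (P t)) -> measurable [set x | exists t, P t x].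
Proof.
move=> mP; rewrite (_ : [set _ | _] = \bigcup_(t in setT) P t).
  by apply: countable_bigcupT_measurable.
by apply/seteqP; split=> x [t] => [Px|_ Px]; exists t.
Qed.

Lemma measurable_implyb (b : bool) (disp : measure_display)
    (X : measurableType disp) (P : set X) :
  (b -> measurable P) -> measurable [set x | b -> P x].
Proof.
case: b => mP.
  rewrite (_ : [set _ | _] = P); first exact: mP.
  by apply/seteqP; split=> x /=; [apply|].
by rewrite (_ : [set _ | _] = setT); [exact: measurableT|apply/seteqP; split].
Qed.

Lemma measurable_andb (b : bool) (disp : measure_display)
    (X : measurableType disp) (P : set X) :
  (b -> measurable P) -> measurable [set x | b /\ P x].
Proof.
case: b => mP.
  rewrite (_ : [set _ | _] = P); first exact: mP.
  by apply/seteqP; split=> x /= => [[]|].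
by rewrite (_ : [set _ | _] = set0); [exact: measurable0|apply/seteqP; split=> // x []].
Qed.

Section Measurability.
Context (R : realType) (d : nat) (L : {fset 'rV[int]_d}).
Hypothesis d_ge1 : (1 <= d)%N.
Implicit Types (eta zeta : config R L) (x y : L) (W U : {set L}) (s : seq L).

Lemma measurable_height x : measurable_fun [set: config R L] (fun eta : config R L => height eta x).
Proof. exact: measurable_tnth. Qed.

Lemma measurable_mkconfig (disp : measure_display) (X : measurableType disp)
    (f : X -> L -> R) : (forall x, measurable_fun setT (f ^~ x)) ->
  measurable_fun setT (fun t => mkconfig (f t)).
Proof.
move=> mf; apply/measurable_fun_tnthP => i.
rewrite (_ : _ \o _ = f ^~ (enum_val i)); first exact: mf.
by apply/funext => t /=; rewrite tnth_mktuple.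
Qed.

Lemma measurable_translate (t : L -> R) :
  measurable_fun [set: config R L] (translate t).
Proof.
apply: measurable_mkconfig => x; apply: measurable_funD => //.
exact: measurable_height.
Qed.

Lemma measurable_preimage_translate (t : L -> R) (B : set (config R L)) :
  measurable B -> measurable (translate t @^-1` B).
Proof. by move=> mB; rewrite -[X in measurable X]setTI; exact: measurable_translate. Qed.

Lemma measurable_height_ge x (r : R) :
  measurable [set eta : config R L | r <= height eta x].
Proof.
rewrite -[X in measurable X]setTI.
have -> : [set eta : config R L | r <= height eta x] = (fun eta : config R L => height eta x) @^-1` `[r, +oo[.
  by apply/seteqP; split=> eta /=; rewrite in_itv/= andbT.
exact: measurable_height.
Qed.

Lemma measurable_height_lt x (r : R) :
  measurable [set eta : config R L | height eta x < r].
Proof.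
rewrite (_ : [set _ | _] = ~` [set eta | r <= height eta x]).
  by apply: measurableC; exact: measurable_height_ge.
by apply/seteqP; split=> eta /=; rewrite ltNge => /negP.
Qed.

Lemma measurable_height_le x (r : R) :
  measurable [set eta : config R L | height eta x <= r].
Proof.
rewrite -[X in measurable X]setTI.
have -> : [set eta : config R L | height eta x <= r] = (fun eta : config R L => height eta x) @^-1` `]-oo, r].
  by apply/seteqP; split=> eta /=; rewrite in_itv.
exact: measurable_height.
Qed.

Lemma measurable_Omega : measurable (Omega R L).
Proof.
apply: measurable_forall_fin => x.
rewrite (_ : (fun eta => _) =
  [set eta : config R L | 0 <= height eta x] `&` [set eta | height eta x < 1]).
  apply: measurableI; first exact: measurable_height_ge.
  exact: measurable_height_lt.
by apply/seteqP; split=> eta /= => [/andP[]|[-> ->]].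
Qed.

Lemma measurable_unforbidden (e : R) U : measurable [set eta | unforbidden e U eta].
Proof.
have -> : [set eta | unforbidden e U eta] = [set eta : config R L | forall W,
    [set eta : config R L | (W != finset.set0) && (W \subset U) ->
      [set eta : config R L | exists x, [set eta : config R L | (x \in W) /\
        (2 * d)%:R^-1 * (degree R W x)%:R - e <= height eta x] eta] eta] eta].
  apply/seteqP; split=> eta /= H W.
    by case/andP=> W0 WU; have [x xW Hx] := H W W0 WU; exists x.
  by move=> W0 WU; have [|x []//] := H W; [rewrite W0 WU|exists x].
apply: measurable_forall_fin => W; apply: measurable_implyb => _.
apply: measurable_exists_fin => x; apply: measurable_andb => _.
exact: measurable_height_ge.
Qed.

Lemma measurable_legal s : measurable [set eta : config R L | legal eta s].
Proof.
elim: s => [|x s IH] /=; first exact: measurableT.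
apply: measurableI; first exact: measurable_height_ge.
exact: (measurable_preimage_translate (fun y => - Delta R x y) IH).
Qed.

Lemma measurable_allowed : measurable (allowed R L).
Proof.
rewrite (_ : allowed R L = Omega R L `&` [set eta | unforbidden 0 finset.setT eta]).
  by apply: measurableI; [exact: measurable_Omega|exact: measurable_unforbidden].
by apply/seteqP; split=> eta /allowedE.
Qed.

(* By uniqueness of the stabilization, [add_op u x] is a fixed translation on each
   of these countably many sets. *)
Definition stabilized_by (u : R) x s : set (config R L) :=
  [set eta | legal (translate (deposit u x) eta) s /\
     Omega R L (foldl (@topple R d L) (translate (deposit u x) eta) s)].

Definition add_shift (u : R) x s : L -> R :=
  fun y => deposit u x y - lap (odometer R s) y.

Lemma stabilized_byE u x s eta : stabilized_by u x s eta ->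
  add_op u x eta = translate (add_shift u x s) eta.
Proof.
move=> [ls Os]; rewrite (@add_opE _ _ _ d_ge1 u x eta
    (foldl (@topple R d L) (translate (deposit u x) eta) s)).
  rewrite foldl_topple translateD; apply: eq_translate => y.
  by rewrite addrC.
by split=> //; exists s.
Qed.

Lemma measurable_stabilized_by u x s : measurable (stabilized_by u x s).
Proof.
apply: measurableI.
  exact: (measurable_preimage_translate (deposit u x) (measurable_legal s)).
rewrite (_ : (fun eta => _) = translate (fun y => deposit u x y - lap (odometer R s) y)
  @^-1` Omega R L).
  exact: measurable_preimage_translate measurable_Omega.
apply/funext => eta; rewrite foldl_topple translateD /=; congr (Omega R L _).
by apply: eq_translate => y; rewrite addrC.
Qed.

Lemma measurable_preimage_add_op u x (B : set (config R L)) : 0 <= u ->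
  measurable B -> measurable (Omega R L `&` add_op u x @^-1` B).
Proof.
move=> u0 mB; have -> : Omega R L `&` add_op u x @^-1` B = Omega R L `&`
    [set eta | exists s, (stabilized_by u x s `&`
       translate (add_shift u x s) @^-1` B) eta].
  apply/seteqP; split=> eta /= [Oe] => [Be|[s [Hs]]]; split=> //; last first.
    by rewrite /= (stabilized_byE Hs).
  have [s [ls sE Os]] := add_opP d_ge1 x u0 Oe; exists s.
  have Hs : stabilized_by u x s eta by split=> //; rewrite -sE.
  by split=> //=; rewrite -(stabilized_byE Hs).
apply: measurableI; first exact: measurable_Omega.
apply: measurable_exists_countable => s; apply: measurableI.
  exact: measurable_stabilized_by.
exact: measurable_preimage_translate.
Qed.

End Measurability.

(** * Translation invariance of the volume *)

Lemma sigma_finite_measure_exists (R : realType) (disp : measure_display)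
    (T : measurableType disp) (m : {measure set T -> \bar R}) :
  sigma_finite setT m ->
  exists M : {sigma_finite_measure set T -> \bar R}, M = m :> (set T -> \bar R).
Proof.
move=> sf.
pose H1 := isSFinite.Build _ _ _ m (sfinite_measure_sigma_finite sf).
pose H2 := isSigmaFinite.Build _ _ _ m sf.
pose M := HB.pack_for (SigmaFiniteMeasure.type T R) (Measure.sort m) H1 H2.
by exists M.
Qed.

Section Volume.
Context (R : realType).

Definition cons_pair n (p : measurableTypeR R * n.-tuple R) : n.+1.-tuple R :=
  [tuple of (p.1 : R) :: p.2].

Lemma measurable_cons_pair n : measurable_fun setT (@cons_pair n).
Proof.
apply: measurable_cons; last exact: measurable_snd.
exact: (@measurable_fst _ _ (measurableTypeR R) (n.-tuple R)).
Qed.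

Lemma measurable_uncons n : measurable_fun setT
  (fun t : n.+1.-tuple R => (thead t : measurableTypeR R, [tuple of behead t])).
Proof.
apply/measurable_fun_pairP; split; last exact: measurable_behead.
exact: (measurable_tnth ord0).
Qed.

(** [vol] is a bare set function; the bundled measure gives access to product and uniqueness
    theorems. In the induction the two exhausting sequences are nondecreasing, so the diagonal
    rectangles already cover the product. *)
Lemma vol_sigma_finite n :
  exists m : {sigma_finite_measure set (n.-tuple R) -> \bar R}, @vol R n = m.
Proof.
elim: n => [|n [m IH]].
  by exists [the sigma_finite_measure _ _ of \d_([tuple] : 0.-tuple R)].
pose mp := measure_function_pushforward__canonical__measure_function_Measure
  (lebesgue_measure \x m)%E (@measurable_cons_pair n).
have sf : sigma_finite setT mp.
  have /sigma_finiteP[F [FT ndF Ffin]] := sigma_finiteT (@lebesgue_measure R).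
  have /sigma_finiteP[G [GT ndG Gfin]] := sigma_finiteT m.
  pose g (t : n.+1.-tuple R) : measurableTypeR R * n.-tuple R :=
    (thead t, [tuple of behead t]).
  have gK p : g (cons_pair p) = p.
    by case: p => x t; congr pair; apply: val_inj.
  exists (fun i => g @^-1` (F i `*` G i)) => [|i].
    apply/esym/seteqP; split=> // t _.
    have : setT (g t).1 by []; rewrite FT => -[i _ Fi].
    have : setT (g t).2 by []; rewrite GT => -[j _ Gj].
    exists (maxn i j) => //; split.
      by have /subsetPset := ndF _ _ (leq_maxl i j); exact.
    by have /subsetPset := ndG _ _ (leq_maxr i j); exact.
  have [mF Fi] := Ffin i; have [mG Gi] := Gfin i; split.
    rewrite -[X in measurable X]setTI; apply: measurable_uncons => //.
    exact: measurableX.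
  rewrite /mp /= /pushforward (_ : _ @^-1` _ = F i `*` G i).
    by rewrite [ltLHS]product_measure1E// lte_mul_pinfty// ge0_fin_numE.
  by apply/funext => p; exact: (congr1 (F i `*` G i) (gK p)).
have [M ME] := sigma_finite_measure_exists sf.
by exists M; rewrite ME /= IH.
Qed.

Lemma lebesgue_measure_translate (t : R) (A : set (measurableTypeR R)) :
  measurable A ->
  lebesgue_measure ((fun x : measurableTypeR R => x + t) @^-1` A) = lebesgue_measure A.
Proof.
have mt : measurable_fun setT (fun x : measurableTypeR R => x + t : measurableTypeR R).
  exact: measurable_funD.
move=> mA; apply/esym; pose m := pushforward (@lebesgue_measure R)
  (fun x : measurableTypeR R => x + t : measurableTypeR R).
apply: (@lebesgue_measure_unique R
  (measure_function_pushforward__canonical__measure_function_Measure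
    (@lebesgue_measure R) mt)) mA => _ [[a b] /= ab <-].
rewrite /pushforward.
rewrite (_ : _ @^-1` _ = `]a - t, b - t]%classic); last first.
  by apply/seteqP; split=> x /=; rewrite !in_itv/= ltrBlDr lerBrDr.
rewrite !lebesgue_measure_itv/= !lte_fin ltrD2r.
by case: ifP => // _; rewrite -!EFinB; congr (_%:E); ring.
Qed.

Definition translate_tuple n (t : 'I_n -> R) (e : n.-tuple R) : n.-tuple R :=
  [tuple tnth e i + t i | i < n].

Lemma measurable_translate_tuple n (t : 'I_n -> R) :
  measurable_fun setT (translate_tuple t).
Proof.
apply/measurable_fun_tnthP => i.
rewrite (_ : _ \o _ = fun e => tnth e i + t i); last first.
  by apply/funext => e /=; rewrite tnth_mktuple.
by apply: measurable_funD => //; exact: measurable_tnth.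
Qed.

(** The product measure and its image under a coordinatewise translation agree on rectangles, by the
    one-dimensional case and the induction hypothesis. *)
Lemma vol_translate_tuple n (t : 'I_n -> R) (A : set (n.-tuple R)) :
  measurable A -> vol (translate_tuple t @^-1` A) = vol A.
Proof.
elim: n t A => [|n IH] t A mA.
  congr vol; apply/seteqP; split=> e /=.
    by rewrite (tuple0 e) (tuple0 (translate_tuple _ _)).
  by rewrite (tuple0 e) (tuple0 (translate_tuple _ _)).
have [m mE] := vol_sigma_finite n.
rewrite /= mE /pushforward.
pose g (p : measurableTypeR R * n.-tuple R) : measurableTypeR R * n.-tuple R :=
  (p.1 + t ord0, translate_tuple (fun i => t (lift ord0 i)) p.2).
have mg : measurable_fun setT g.
  apply/measurable_fun_pairP; split.
    exact: (@measurable_funD _ _ R).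
  by apply: measurableT_comp measurable_snd; exact: measurable_translate_tuple.
have mA' : measurable (@cons_pair n @^-1` A).
  by rewrite -[X in measurable X]setTI; exact: measurable_cons_pair.
rewrite [RHS](@product_measure_unique _ _ _ _ _ lebesgue_measure m
  (measure_function_pushforward__canonical__measure_function_Measure
    (lebesgue_measure \x m)%E mg) _ _ mA').
  apply: (congr1 (lebesgue_measure \x m)%E); apply/funext => p.
  apply: (congr1 A (_ : translate_tuple t (cons_pair p) = cons_pair (g p))).
  apply: eq_from_tnth => i; rewrite tnth_mktuple.
  by have [j ->|->//] := unliftP ord0 i; rewrite !tnthS tnth_mktuple.
move=> B C mB mC; rewrite /= /pushforward.
rewrite (_ : g @^-1` (B `*` C) = ((fun x => x + t ord0) @^-1` B) `*`
  (translate_tuple (fun i => t (lift ord0 i)) @^-1` C)) //.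
rewrite [LHS]product_measure1E.
- by congr (_ * _)%E; [exact: lebesgue_measure_translate|rewrite -mE IH].
- rewrite -[X in measurable X]setTI.
  by apply: (@measurable_funD _ _ R) mB => //.
- by rewrite -[X in measurable X]setTI; exact: measurable_translate_tuple.
Qed.

Lemma vol_cube n (a b : R) : a <= b ->
  vol [set e : n.-tuple R | forall i, a <= tnth e i < b] = ((b - a) ^+ n)%:E.
Proof.
move=> ab; elim: n => [|n IH] /=.
  by rewrite diracE mem_set// => -[].
have [m mE] := vol_sigma_finite n.
rewrite /pushforward mE.
rewrite (_ : _ @^-1` _ = `[a, b[%classic `*`
  [set e : n.-tuple R | forall i, a <= tnth e i < b]); last first.
  apply/seteqP; split=> -[x e] /=; rewrite in_itv/=.
    move=> H; split; first exact: (H ord0).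
    by move=> i; have := H (lift ord0 i); rewrite tnthS.
  move=> [H1 H2] i; have [j ->|->//] := unliftP ord0 i.
  by rewrite tnthS.
rewrite [LHS]product_measure1E//; last first.
  apply: measurable_forall_fin => i.
  rewrite (_ : (fun e => _) = (fun e : n.-tuple R => tnth e i) @^-1` `[a, b[).
    by rewrite -[X in measurable X]setTI; exact: measurable_tnth.
  by apply/seteqP; split=> e /=; rewrite in_itv.
rewrite -mE IH [X in (X * _)%E]lebesgue_measure_itv/= lte_fin.
move: ab; rewrite le_eqVlt => /orP[/eqP->|->].
  by rewrite ltxx subrr exprS mul0r mul0e.
by rewrite exprS EFinM EFinB.
Qed.

End Volume.

(** Serves twice: to construct the normalized volume, and to condition it on a level set in the
    proof of ergodicity. *)
Lemma normalized_restriction (R : realType) (disp : measure_display)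
    (T : measurableType disp) (m : {measure set T -> \bar R}) (D : set T) :
  measurable D -> m D \is a fin_num -> m D != 0%E ->
  exists P : probability T R, forall B, measurable B ->
    P B = (fine (m (B `&` D)) / fine (m D))%:E.
Proof.
move=> mD finD D0.
(* [dirac point] is the fallback of [mnormalize] for zero or infinite mass; both cases are excluded
   below. *)
exists [the probability T R of mnormalize (mrestr m mD) (dirac point)] => B mB.
rewrite /= /mnormalize /= /mrestr/= setTI (negbTE D0)/=.
have /negbTE -> : m D != +oo%E by move: finD; rewrite fin_numE => /andP[].
rewrite EFinM fineK// ge0_fin_numE//.
apply: le_lt_trans (_ : _ <= m D)%E _.
  by apply: le_measure; rewrite ?inE//; exact: measurableI.
by move: finD; rewrite ge0_fin_numE.
Qed.

(** * Volume preservation by additions, and positive volume of the allowed set *)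

Section Volume_preservation.
Context (R : realType) (d : nat) (L : {fset 'rV[int]_d}).
Hypotheses (d_ge1 : (1 <= d)%N).
Local Notation X := (config R L).
Implicit Types (eta : X) (t : L -> R) (W : {set L}).

Lemma vol_translate t (A : set X) :
  measurable A -> vol (translate t @^-1` A) = vol A.
Proof.
move=> mA; rewrite -[RHS](vol_translate_tuple (t \o enum_val)) //; congr vol.
apply/funext => eta; congr A; apply: eq_from_tnth => i.
by rewrite !tnth_mktuple /height enum_valK.
Qed.

Lemma translateNK t : cancel (@translate R d L (fun x => - t x)) (translate t).
Proof. by move=> eta; rewrite translateD translate0// => x; rewrite subrr. Qed.

(** Cut the preimage into disjoint pieces on which [f] is a single translation. Their images have
    the same volumes, lie in [D] and [B], and are disjoint because [f] is injective on [D]. *)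
Lemma vol_piecewise_translation_le (D B : set X) (f : X -> X)
    (t : nat -> L -> R) (Q : nat -> set X) :
  measurable D -> measurable B -> measurable (D `&` f @^-1` B) ->
  (forall i, measurable (Q i)) -> D `<=` \bigcup_i Q i ->
  (forall i eta, Q i eta -> f eta = translate (t i) eta) ->
  (forall eta, D eta -> D (f eta)) ->
  (forall eta zeta, D eta -> D zeta -> f eta = f zeta -> eta = zeta) ->
  (vol (D `&` f @^-1` B) <= vol (D `&` B))%E.
Proof.
move=> mD mB mA mQ DQ fQ fD finj; have [m mE] := vol_sigma_finite R #|{: L}|.
pose P n := (D `&` f @^-1` B) `&` seqDU Q n.
have mP n : measurable (P n) by apply: measurableI => //; exact: seqDU_measurable.
have tP : trivIset setT P.
  exact: trivIset_setIl (trivIset_seqDU Q).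
have UP : D `&` f @^-1` B = \bigcup_n P n.
  rewrite -setI_bigcupr -seqDU_bigcup_eq; apply/esym/setIidPl.
  by apply: subset_trans DQ; exact: subIsetl.
pose P' n := translate (fun x => - t n x) @^-1` P n.
have mP' n : measurable (P' n) by exact: measurable_preimage_translate.
have P'f n eta : P' n eta -> exists2 zeta, P n zeta & f zeta = eta.
  move=> Peta; exists (translate (fun x => - t n x) eta) => //.
  rewrite (fQ n) ?translateNK//; have [_] := Peta; exact: subDsetl.
have tP' : trivIset setT P'.
  apply/trivIsetP => i j _ _ ij; apply/seteqP; split=> // eta [/P'f[z zP <-]].
  move=> /P'f[z' z'P] /finj z'z; have {z'z} z'z : z' = z.
    by apply: z'z; [case: z'P => -[]|case: zP => -[]].
  rewrite z'z in z'P; move/trivIsetP : tP => /(_ _ _ Logic.I Logic.I ij) => PP.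
  by have : (P i `&` P j) z by []; rewrite PP.
rewrite UP mE measure_semi_bigcup//; last by rewrite -UP.
have mPP' n : m (P n) = m (P' n) by rewrite -mE /P' vol_translate.
rewrite (eq_eseriesr (fun n _ => mPP' n)).
rewrite -[X in (X <= _)%E](@measure_semi_bigcup _ _ _ m P')//; last first.
  exact: bigcupT_measurable.
apply: le_measure; rewrite ?inE//; [exact: bigcupT_measurable|exact: measurableI|].
move=> eta [n _] /P'f[zeta [[Dz Bz] _] <-]; split=> //; exact: fD.
Qed.

(** The inequality holds for [B] and for its complement, and on both sides the two volumes add up to
    the finite volume of [D]; hence both are equalities. Surjectivity of [f] never has to be
    established. *)
Lemma vol_piecewise_translation (D B : set X) (f : X -> X)
    (t : nat -> L -> R) (Q : nat -> set X) :
  measurable D -> (vol D < +oo)%E ->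
  (forall B, measurable B -> measurable (D `&` f @^-1` B)) ->
  (forall i, measurable (Q i)) -> D `<=` \bigcup_i Q i ->
  (forall i eta, Q i eta -> f eta = translate (t i) eta) ->
  (forall eta, D eta -> D (f eta)) ->
  (forall eta zeta, D eta -> D zeta -> f eta = f zeta -> eta = zeta) ->
  measurable B -> vol (D `&` f @^-1` B) = vol (D `&` B).
Proof.
move=> mD finD mf mQ DQ fQ fD finj mB.
have le C : measurable C -> (vol (D `&` f @^-1` C) <= vol (D `&` C))%E.
  by move=> mC; exact: (vol_piecewise_translation_le mD mC (mf _ mC) mQ DQ fQ).
have [m mE] := vol_sigma_finite R #|{: L}|.
have fin_m E : measurable E -> E `<=` D -> m E \is a fin_num.
  move=> mE' ED; rewrite ge0_fin_numE//; apply: le_lt_trans finD.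
  by rewrite mE; apply: le_measure; rewrite ?inE.
have mfB := mf _ mB; have mfB' := mf _ (measurableC mB).
have splitB : (m D = m (D `&` ~` B) + m (D `&` B))%E.
  by rewrite -setDE; exact: measureDI.
have splitf : (m D = m (D `&` f @^-1` (~` B)) + m (D `&` f @^-1` B))%E.
  rewrite (measureDI m mD mfB); congr (m _ + m _)%E.
    by apply/seteqP; split=> eta /= [Deta]; [move=> H; split=> // ?; apply: H
      |move=> H; split=> // -[]].
  by apply/seteqP; split=> eta /= [] // ? [].
have := le _ mB; have := le _ (measurableC mB); rewrite !mE.
move: splitf; rewrite splitB.
have mDB : measurable (D `&` B) by exact: measurableI.
have mDB' : measurable (D `&` ~` B) by apply: measurableI => //; exact: measurableC.
rewrite -(fineK (fin_m _ mfB (@subIsetl _ _ _))).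
rewrite -(fineK (fin_m _ mfB' (@subIsetl _ _ _))).
rewrite -(fineK (fin_m _ mDB (@subIsetl _ _ _))).
rewrite -(fineK (fin_m _ mDB' (@subIsetl _ _ _))).
rewrite -!EFinD !lee_fin => -[] E1 le1 le2; congr (_%:E).
lra.
Qed.

Lemma Omega_cube : Omega R L = [set e : X | forall i, 0 <= tnth e i < 1].
Proof.
apply/seteqP; split=> eta /= H i; last exact: H.
by have := H (enum_val i); rewrite /height enum_valK.
Qed.

Lemma vol_Omega : vol (Omega R L) = 1%E.
Proof. by rewrite Omega_cube vol_cube// subr0 expr1n. Qed.

(** At a minimum of [w] over [W], having 2d neighbours in [W] would force [lap w <= 0]. *)
Lemma degree_lt W : W != finset.set0 ->
  exists2 x, x \in W & (degree R W x < 2 * d)%N.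
Proof.
move=> /set0Pn[x0 x0W]; have [w [w0 w1]] := @lap_superharmonic R d L d_ge1.
pose x := [arg min_(x < x0 | x \in W) w x]%O.
have [xW xP] : x \in W /\ forall y, y \in W -> w x <= w y.
  by rewrite /x; case: arg_minP.
exists x => //; rewrite ltnNge; apply/negP => H.
have := w1 x; rewrite /lap.
have : (2 * d)%:R * w x <= \sum_(y | neighbour R x y) w y.
  apply: le_trans (_ : (degree R W x)%:R * w x <= _).
    by rewrite ler_wpM2r ?ler_nat// ltW.
  rewrite degreeE mulr_suml; apply: ler_sum => y _.
  by case: (boolP (y \in W)) => [/xP|_]; rewrite ?mul1r// mul0r ltW.
have d2 : 0 < (2 * d)%:R :> R by rewrite -invr_gt0 inv2d_gt0.
by rewrite -ler_pdivlMl// => ?; lra.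
Qed.

(** The cube of heights in [1 - 1/(2d), 1) is allowed: by [degree_lt] every nonempty [W] has a site
    with at most 2d - 1 neighbours in [W]. *)
Lemma vol_allowed_gt0 : (0 < vol (allowed R L))%E.
Proof.
have [m mE] := vol_sigma_finite R #|{: L}|.
have c0 := inv2d_gt0 R d_ge1.
pose c : R := (2 * d)%:R^-1; have c1 : c <= 1.
  rewrite invf_le1 ?ler1n ?muln_gt0// ltr0n muln_gt0//.
have : (0 < vol [set e : X | forall i, (1 - c <= tnth e i < 1)%R])%E.
  by rewrite vol_cube ?lte_fin ?exprn_gt0//; rewrite /c; lra.
move=> /lt_le_trans; apply; rewrite mE; apply: le_measure; rewrite ?inE.
- apply: measurable_forall_fin => i.
  rewrite (_ : (fun e => _) = (fun e : X => tnth e i) @^-1` `[1 - c, 1[).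
    by rewrite -[X in measurable X]setTI; exact: measurable_tnth.
  by apply/seteqP; split=> e /=; rewrite in_itv.
- exact: measurable_allowed.
move=> eta H; apply/allowedE; split=> [|W W0 _].
  by move=> x; have := H (enum_rank x); rewrite /height; lra.
have [x xW dx] := degree_lt W0; exists x => //.
have /andP[+ _] := H (enum_rank x); rewrite subr0 => /(le_trans _); apply.
rewrite -[c]mulr1 -/c lerBrDr -mulrDr mulrC -[X in _ + X]/(1%:R) -natrD addn1.
by rewrite ler_pdivrMr ?mul1r ?ler_nat// ltr0n muln_gt0.
Qed.

Lemma vol_allowed_le1 : (vol (allowed R L) <= 1)%E.
Proof.
have [m mE] := vol_sigma_finite R #|{: L}|.
rewrite -vol_Omega mE; apply: le_measure; rewrite ?inE.
- exact: measurable_allowed.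
- exact: measurable_Omega.
- by move=> eta [].
Qed.

Lemma vol_allowed_add_op u x (B : set X) : 0 <= u -> measurable B ->
  vol (allowed R L `&` add_op u x @^-1` B) = vol (allowed R L `&` B).
Proof.
(* [e] enumerates the toppling words. Codes of no word give the empty word; the resulting
   repetitions are harmless, since the covering sets may overlap. *)
move=> u0 mB; pose e (n : nat) := odflt ([::] : seq L) (choice.unpickle n).
apply: (@vol_piecewise_translation _ _ _ (fun n => add_shift u x (e n))
  (fun n => stabilized_by u x (e n))) => //.
- exact: measurable_allowed.
- by apply: le_lt_trans vol_allowed_le1 _; rewrite ltry.
- move=> C mC; rewrite (_ : _ `&` _ =
    allowed R L `&` (Omega R L `&` add_op u x @^-1` C)).
    apply: measurableI; first exact: measurable_allowed.
    exact: measurable_preimage_add_op.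
  by apply/seteqP; split=> eta [Ae]; [split=> //; split=> //; case: Ae|move=> [] _ ?; split].
- by move=> n; exact: measurable_stabilized_by.
- move=> eta [Oe _]; have [s [ls sE Os]] := add_opP d_ge1 x u0 Oe.
  exists (choice.pickle s) => //; rewrite /e choice.pickleK/=; split=> //.
  by rewrite -sE.
- by move=> n eta; exact: stabilized_byE.
- by move=> eta; exact: allowed_add_op.
- by move=> eta zeta; exact: add_op_inj.
Qed.

End Volume_preservation.

(** * Invariant measures charge only allowed configurations *)

Section Invariance.
Context (R : realType) (d : nat) (L : {fset 'rV[int]_d}) (a : R).
Hypotheses (d_ge1 : (1 <= d)%N) (L_neq0 : L != fset0) (a_gt0 : 0 < a).
Local Notation X := (config R L).
Local Notation n := #|{: L}|.
Implicit Types (eta : X) (nu : probability X R) (g : L -> R) (U : {set L}).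

Let a_ge0 : 0 <= a. Proof. exact: ltW. Qed.

Lemma card_sites_gt0 : (0 < n)%N.
Proof. by have /fset0Pn[p Lp] := L_neq0; apply/card_gt0P; exists [` Lp]%fset. Qed.

Lemma avg_eq (r : L -> R) (s : R) : (forall x, s <= r x) ->
  s = n%:R^-1 * \sum_x r x -> forall x, r x = s.
Proof.
move=> sr sE x; apply/eqP; rewrite -subr_eq0.
have : \sum_x (r x - s) == 0.
  rewrite sumrB sumr_const -[s *+ _]mulr_natl [X in _ * X]sE mulrA divff ?mul1r ?subrr//.
  by rewrite pnatr_eq0 -lt0n card_sites_gt0.
rewrite psumr_eq0 => [|y _]; last by rewrite subr_ge0.
by move=> /allP/(_ x (mem_index_enum _)).
Qed.

Lemma invariant_fine nu : invariant_probability a nu ->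
  forall B, measurable B -> B `<=` Omega R L ->
  fine (nu B) = n%:R^-1 * \sum_(x : L) fine (nu (Omega R L `&` add_op a x @^-1` B)).
Proof.
move=> [_ H] B mB BO; rewrite H// sum_fine; last first.
  by move=> x _; apply: fin_num_measure; exact: measurable_preimage_add_op.
rewrite fineM//; apply/sum_fin_numP => x _ _.
by apply: fin_num_measure; exact: measurable_preimage_add_op.
Qed.

Lemma fine_measure_le nu (A B : set X) : measurable A -> measurable B -> A `<=` B ->
  fine (nu A) <= fine (nu B).
Proof.
move=> mA mB AB; apply: fine_le; rewrite ?fin_num_measure//.
by apply: le_measure; rewrite ?inE.
Qed.

Lemma fine_measure_le1 nu (A : set X) : measurable A -> fine (nu A) <= 1.
Proof. by move=> mA; rewrite -lee_fin fineK ?fin_num_measure ?probability_le1. Qed.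

(** Every preimage contains [C], so has at least its mass; the average of these masses is the mass
    of [C], so all are equal to it. *)
Lemma invariant_closed nu (C : set X) : invariant_probability a nu ->
  measurable C -> C `<=` Omega R L ->
  (forall x eta, C eta -> C (add_op a x eta)) ->
  forall x, fine (nu (Omega R L `&` add_op a x @^-1` C)) = fine (nu C).
Proof.
move=> inv mC CO CA; apply: avg_eq; last exact: invariant_fine.
move=> x; apply: fine_measure_le => //; first exact: measurable_preimage_add_op.
by move=> eta Ce; split; [exact: CO|exact: CA].
Qed.

(* These sets are closed under every [add_op a y], and an addition at [x] raises
   [j]: unless [x] topples, its height only grows. *)
Definition partly_unforbidden U x (j : nat) : set X :=
  [set eta | [/\ Omega R L eta, unforbidden 0 U eta &
    unforbidden 0 (x |: U)%SET eta \/ j%:R * a <= height eta x]].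

Lemma measurable_partly_unforbidden U x j : measurable (partly_unforbidden U x j).
Proof.
rewrite (_ : partly_unforbidden U x j = Omega R L `&` ([set eta | unforbidden 0 U eta] `&`
  ([set eta | unforbidden 0 (x |: U)%SET eta] `|` [set eta | j%:R * a <= height eta x]))).
  apply: measurableI; first exact: measurable_Omega.
  apply: measurableI; first exact: measurable_unforbidden.
  by apply: measurableU; [exact: measurable_unforbidden|exact: measurable_height_ge].
by apply/seteqP; split=> eta /= => [[]|[] ? []].
Qed.

Lemma partly_unforbidden_add_op U x j y eta : partly_unforbidden U x j eta ->
  partly_unforbidden U x (j + (y == x)) (add_op a y eta).
Proof.
move=> [Oe He Hj]; have [s [ls sE Os]] := add_opP d_ge1 y a_ge0 Oe.
split=> //; first exact: unforbidden_add_op.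
have [H|nH] := pselect (unforbidden 0 (x |: U)%SET (add_op a y eta)); [by left|right].
case: Hj => [H|Hj]; first by case: nH; exact: unforbidden_add_op.
have [xs|xs] := boolP (x \in s).
  case: nH; rewrite sE; apply: (@unforbiddenS _ _ _ _ (U :|: [set x in s])%SET).
    by apply/fintype.subsetP => z; rewrite !inE => /orP[/eqP->|->//]; rewrite xs orbT.
  apply: unforbidden_run => //; apply: unforbiddenW He => z.
  exact: height_deposit_le.
rewrite sE; apply: le_trans (height_run_notin d_ge1 _ xs).
rewrite height_translate /deposit natrD mulrDl (eq_sym y) [_ * a]mulrC.
by rewrite [X in _ + X]mulrC lerD2r mulrC.
Qed.

Lemma invariant_unforbidden nu : invariant_probability a nu ->
  forall s : seq L,
  fine (nu (Omega R L `&` [set eta | unforbidden 0 [set x in s]%SET eta])) = 1.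
Proof.
move=> inv; elim=> [|x s IH].
  rewrite (_ : _ `&` _ = Omega R L); first by case: inv => ->.
  apply/seteqP; split=> eta /= => [[]//|Oe]; split=> // W W0.
  by rewrite (_ : [set _ in _]%SET = finset.set0) ?finset.subset0 ?(negbTE W0)//;
    apply/setP => y; rewrite !inE.
set U := [set y in s]%SET in IH *.
have C1 j : fine (nu (partly_unforbidden U x j)) = 1.
  elim: j => [|j IHj].
    rewrite -[RHS]IH; congr (fine (nu _)); apply/seteqP; split=> eta /= => [[]//|[Oe He]].
    by split=> //; right; rewrite mul0r; have /andP[] := Oe x.
  have mC := measurable_partly_unforbidden U x j.+1.
  apply/eqP; rewrite eq_le; apply/andP; split.
    by rewrite fine_measure_le1.
  (* An addition at [x] sends stage [j] into stage [j.+1], which is closed under all additions; so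
     its preimage, and hence stage [j.+1] itself, has full mass. *)
  rewrite -[leLHS]IHj -(@invariant_closed _ _ inv mC _ _ x).
  - apply: fine_measure_le; first exact: measurable_partly_unforbidden.
      exact: measurable_preimage_add_op.
    move=> eta Ce; split; first by case: Ce.
    by have := partly_unforbidden_add_op x Ce; rewrite eqxx addn1.
  - by move=> eta [].
  - move=> y eta /(partly_unforbidden_add_op y)[Oe He Hj]; split=> //.
    case: Hj => [?|Hj]; [by left|right]; apply: le_trans Hj.
    by rewrite ler_pM2r// ler_nat leq_addr.
(* At stage [K] the alternative [K%:R * a <= height eta x] contradicts stability, so [x] joins the
   protected set. *)
have [K K1] : exists K : nat, 1 <= K%:R * a.
  exists (Num.truncn a^-1).+1; rewrite -ler_pdivrMr// div1r ltW//.
  exact: truncnS_gt.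
rewrite -[RHS](C1 K); congr (fine (nu _)); apply/seteqP; split=> eta /=.
  move=> [Oe H]; split=> //.
    apply: unforbiddenS H; apply/fintype.subsetP => y; rewrite !inE => ->.
    by rewrite orbT.
  by left; apply: unforbiddenS H; apply/fintype.subsetP => y; rewrite !inE.
move=> [Oe He []] H; split=> //.
  by apply: unforbiddenS H; apply/fintype.subsetP => y; rewrite !inE.
by have /andP[_] := Oe x; rewrite ltNge (le_trans K1 H).
Qed.

Lemma invariant_allowed nu : invariant_probability a nu -> nu (allowed R L) = 1%E.
Proof.
move=> inv; rewrite -[LHS]fineK ?fin_num_measure//; last exact: measurable_allowed.
rewrite -(invariant_unforbidden inv (enum {: L})); congr (fine (nu _))%:E.
have -> : [set x in enum {: L}]%SET = finset.setT.
  by apply/setP => y; rewrite !inE mem_enum.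
by apply/seteqP; split=> eta /allowedE.
Qed.

End Invariance.

(** * Uniform density of the multiples of an irrational number *)

Section Kronecker.
Context (R : realType).
Implicit Types (a t delta : R) (D : nat).

Lemma irrational_relation a D (q : nat) (p : int) : irrational a ->
  (0 < D)%N -> (0 < q)%N -> a * q%:R - D%:R * p%:~R != 0.
Proof.
move=> a_irr D0 q0; apply/eqP => E; apply: a_irr.
apply/rationalP; exists (D%:Z * p), q.
rewrite intrM -pmulrn; apply: (canRL (mulfK _)).
  by rewrite pnatr_eq0 -lt0n.
by apply/eqP; rewrite -subr_eq0 E.
Qed.

(** Pigeonhole: among [N + 1] multiples of [a] modulo [D], two fall into the same of [N] bins of
    width [D / N <= delta]. Irrationality keeps their difference nonzero. *)
Lemma dirichlet a D delta : irrational a -> (0 < D)%N -> 0 < delta ->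
  exists (q : nat) (p : int),
    `|a * q%:R - D%:R * p%:~R| <= delta /\ a * q%:R - D%:R * p%:~R != 0.
Proof.
move=> a_irr D0 delta0.
have DR : 0 < D%:R :> R by rewrite ltr0n.
pose N := (Num.truncn (D%:R / delta)).+1.
have NR : 0 < N%:R :> R by rewrite ltr0n.
have DN : D%:R / N%:R <= delta.
  by rewrite ler_pdivrMr// mulrC -ler_pdivrMr// ltW// truncnS_gt.
pose fl (i : nat) : int := Num.floor (a * i%:R / D%:R).
pose fr (i : nat) : R := a * i%:R - D%:R * (fl i)%:~R.
have fr_itv i : 0 <= fr i < D%:R.
  have /andP[f1 f2] := floor_itv (a * i%:R / D%:R).
  rewrite ler_pdivlMr// in f1; rewrite ltr_pdivrMr// rmorphD/= in f2.
  by rewrite /fr /fl; apply/andP; split; lra.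
have y_ge0 i : 0 <= fr i * (N%:R / D%:R).
  by have /andP[? _] := fr_itv i; rewrite mulr_ge0// divr_ge0// ltW.
have bin_lt i : (Num.truncn (fr i * (N%:R / D%:R)) < N)%N.
  have /andP[f1 f2] := fr_itv i.
  rewrite truncn_lt_nat//.
  by rewrite mulrA ltr_pdivrMr// mulrC ltr_pM2l.
pose bin (i : 'I_N.+1) : 'I_N := Ordinal (bin_lt i).
have /injectivePn[i [j ij E]] : ~~ injectiveb bin.
  apply/injectiveP => /leq_card; rewrite !card_ord; by rewrite ltnn.
wlog ji : i j ij E / (j < i)%N.
  move=> H; have := ij; rewrite neq_ltn => /orP[] ?; last exact: (H i j).
  by apply: (H j i); rewrite 1?eq_sym.
exists (i - j)%N, (fl i - fl j).
have -> : a * (i - j)%:R - D%:R * (fl i - fl j)%:~R = fr i - fr j.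
  by rewrite natrB ?(ltnW ji)// rmorphB/= /fr; ring.
split.
  apply: le_trans DN.
  have /(congr1 val)/= {}E := E.
  have /andP[] := truncn_itv (y_ge0 i); have /andP[] := truncn_itv (y_ge0 j).
  rewrite E -[(Num.truncn _).+1]addn1 natrD => j1 j2 i1 i2.
  have -> : fr i - fr j =
      (fr i * (N%:R / D%:R) - fr j * (N%:R / D%:R)) * (D%:R / N%:R).
    by field; rewrite !gt_eqF.
  have r0 : 0 <= D%:R / N%:R :> R by rewrite divr_ge0// ltW.
  rewrite normrM (ger0_norm r0) ler_piMl// ltW// ltr_norml.
  by apply/andP; split; lra.
have := @irrational_relation a D (i - j)%N (fl i - fl j) a_irr D0.
rewrite subn_gt0 => /(_ ji).
by rewrite natrB ?(ltnW ji)// rmorphB/= /fr; congr (_ != _); ring.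
Qed.

(** Nonzero steps of size at most [delta] sweep a whole period. Only [k >= 0] is admissible, as mass
    is only added, and [m] must not depend on [t], as it will bound the length of walks. *)
Lemma kronecker a D delta : irrational a -> (0 < D)%N -> 0 < delta ->
  exists m : nat, forall t, exists2 k : nat, (k <= m)%N &
    exists j : int, `|a * k%:R - t - D%:R * j%:~R| <= delta.
Proof.
move=> a_irr D0 delta0.
have [q [p [e_le e0]]] := dirichlet a_irr D0 delta0.
set e := a * q%:R - _ in e_le e0.
have DR : 0 < D%:R :> R by rewrite ltr0n.
pose M := Num.truncn (D%:R / `|e|).
exists (q * M)%N => t.
(* [j] places [t] modulo [D] on the side of 0 towards which [e] points, at distance at most [D]; a
   nonnegative number of steps, at most [M], then reaches it. *)
have [j /andP[j1 j2]] : exists j : int, 0 <= (t - D%:R * j%:~R) / e <= D%:R / `|e|.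
  have /andP[f1 f2] := floor_itv (t / D%:R).
  rewrite ler_pdivlMr// in f1; rewrite ltr_pdivrMr// rmorphD/= in f2.
  have [e_gt0|e_lt0|/eqP] := ltgtP 0 e; last by rewrite eq_sym (negbTE e0).
    exists (Num.floor (t / D%:R)); rewrite gtr0_norm// divr_ge0//=; [|lra|lra].
    by rewrite ler_pM2r ?invr_gt0//; lra.
  exists (Num.floor (t / D%:R) + 1); rewrite ltr0_norm// rmorphD/=.
  set X := t - _; have -> : X / e = (- X) / (- e) by rewrite invrN mulrNN.
  have ? : 0 < - e by rewrite oppr_gt0.
  rewrite divr_ge0//= /X; [|lra|exact: ltW].
  by rewrite ler_pM2r ?invr_gt0//; lra.
set l := Num.truncn ((t - D%:R * j%:~R) / e).
exists (q * l)%N.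
  by rewrite leq_mul2l le_truncn ?orbT.
exists (p * l%:Z - j)%R.
have -> : a * (q * l)%:R - t - D%:R * (p * l%:Z - j)%:~R =
    l%:R * e - (t - D%:R * j%:~R).
  by rewrite natrM rmorphB rmorphM/= -pmulrn /e; ring.
apply: le_trans e_le.
have /andP[] := truncn_itv j1; rewrite -/l -[l.+1]addn1 natrD.
set x := (t - _) / e => l1 l2.
have -> : t - D%:R * j%:~R = x * e by rewrite divfK.
by rewrite -mulrBl normrM ler_piMl// ler_norml; apply/andP; split; lra.
Qed.

End Kronecker.

Lemma inv_nat_le_fin (R : realType) (T : finType) (f : T -> R) :
  (forall t, 0 < f t) -> exists k : nat, forall t, k.+1%:R^-1 <= f t.
Proof.
move=> f0; pose m := \big[Order.min/1]_(t : T) f t.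
have m0 : 0 < m.
  by rewrite /m; elim/big_ind : _ => // r s r0 s0; rewrite lt_min r0.
exists (Num.truncn m^-1) => t; apply: le_trans (_ : m <= _).
  rewrite -[leRHS]invrK lef_pV2 ?posrE ?ltr0n ?invr_gt0// ltW//.
  exact: truncnS_gt.
exact: bigmin_le_cond.
Qed.

(** * Thickened lattice-periodic sets *)

Section Periodization.
Context (R : realType) (d : nat) (L : {fset 'rV[int]_d}).
Hypotheses (d_ge1 : (1 <= d)%N).
Local Notation X := (config R L).
Local Notation ilap v := (lap (fun z => (v z : int)%:~R : R)).
Implicit Types (eta zeta : X) (c g : L -> R) (e delta : R).

Definition below c e : set X :=
  [set eta | (forall x, height eta x <= c x + e) /\ unforbidden e finset.setT eta].

(* As [e] tends to 0 these lattice-periodic sets decrease, on allowed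
   configurations, to the configurations bounded by [c]. *)
Definition periodized c e : set X :=
  [set eta | exists v : {ffun L -> int}, below c e (translate (ilap v) eta)].

Lemma measurable_below c e : measurable (below c e).
Proof.
apply: measurableI; last exact: measurable_unforbidden.
by apply: measurable_forall_fin => x; exact: measurable_height_le.
Qed.

Lemma measurable_periodized c e : measurable (periodized c e).
Proof.
apply: measurable_exists_countable => v.
exact: measurable_preimage_translate (measurable_below c e).
Qed.

Lemma periodized_ilap c e (v : L -> int) eta :
  periodized c e (translate (ilap v) eta) <-> periodized c e eta.
Proof.
have H w xi : periodized c e xi -> periodized c e (translate (ilap w) xi).
  move=> [u Hu]; exists [ffun x => u x - w x]; rewrite translateD.
  rewrite (_ : translate _ xi = translate (ilap u) xi)//.
  apply: eq_translate => x; rewrite -lapD; congr (lap _ x); apply/funext => y.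
  by rewrite ffunE rmorphB/= subrK.
split=> [|/H//]; move=> /(H (fun x => - v x)); rewrite translateD translate0//.
move=> x; rewrite -lapD -[RHS](lap0 R x); congr (lap _ x); apply/funext => y.
by rewrite rmorphN/= addNr.
Qed.

Lemma periodized_near c e delta eta zeta :
  (forall x, `|height zeta x - height eta x| <= delta) ->
  periodized c e eta -> periodized c (e + delta) zeta.
Proof.
move=> near [v [le un]]; exists v; split=> [x|W W0 WT].
  have := le x; rewrite !height_translate; have := near x.
  by rewrite ler_norml => /andP[]; lra.
have [x xW Hx] := un W W0 WT; exists x => //.
move: Hx; rewrite !height_translate; have := near x.
by rewrite ler_norml => /andP[]; lra.
Qed.

(** The topplings in [add_op] amount to a lattice vector, which [periodized] does not see; only the
    deposit remains. *)
Lemma periodized_add_op c e g u x eta : 0 <= u -> Omega R L eta ->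
  periodized c e (translate g (add_op u x eta)) <->
  periodized c e (translate (fun y => g y + deposit u x y) eta).
Proof.
move=> u0 Oe; have [v ->] := add_op_translate d_ge1 x u0 Oe.
rewrite -(periodized_ilap c e v).
rewrite (_ : translate _ _ = translate (fun y => g y + deposit u x y) eta)//.
by apply: height_inj => y; rewrite !height_translate; ring.
Qed.

Lemma periodized_allowed c eta : allowed R L eta ->
  (forall x, height eta x <= c x) -> periodized c 0 eta.
Proof.
move=> /allowedE[_ un] le; exists [ffun=> 0]; rewrite translate0 => [|x].
  by split=> // x; rewrite addr0.
by rewrite -[RHS](lap0 R x); congr (lap _ x); apply/funext => y; rewrite ffunE.
Qed.

Lemma allowed_periodized c eta : (forall x, c x < 1) -> allowed R L eta ->
  (forall k : nat, periodized c k.+1%:R^-1 eta) -> forall x, height eta x <= c x.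
Proof.
move=> c1 /allowedE[Oe un] per x.
apply/ler_addgt0Pr => e e_gt0.
(* The bound [e] serves the final estimate. The other two make [unforbidden_eq] applicable, so that
   the representative found in [below] is [eta] itself; halving makes them strict. *)
have [|k kP] := @inv_nat_le_fin R L
    (fun y => Order.min e (Order.min (1 - height eta y) (1 - c y) / 2)).
  move=> y; rewrite lt_min e_gt0 divr_gt0// lt_min !subr_gt0 c1 andbT.
  by have /andP[] := Oe y.
have kP' y : k.+1%:R^-1 < 1 - height eta y /\ k.+1%:R^-1 < 1 - c y.
  have : 0 < k.+1%:R^-1 :> R by rewrite invr_gt0.
  have := kP y; set z := k.+1%:R^-1.
  rewrite le_min ler_pdivlMr// le_min => /andP[_ /andP[z1 z2]] z0.
  by split; lra.
move: (per k) kP kP'; set z := k.+1%:R^-1 => -[v [le un']] kP kP'.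
have E : eta = translate (ilap v) eta.
  apply/esym/(@unforbidden_eq _ _ _ d_ge1 z (fun x => - v x)).
  - apply: eq_translate => y; rewrite -lapN; congr (lap _ y).
    by apply/funext => w; rewrite rmorphN/= opprK.
  - exact: un'.
  - by move=> y; have [] := kP' y; lra.
  - exact: un.
  - by move=> y; have [] := kP' y; have := le y; lra.
have := le x; rewrite -E => /le_trans; apply.
by rewrite lerD2l; have := kP x; rewrite le_min => /andP[].
Qed.

Definition shifted_mass (nu : probability X R) c e g : R :=
  fine (nu (translate g @^-1` periodized c e)).

Lemma measurable_shifted c e g : measurable (translate g @^-1` periodized c e).
Proof. exact: measurable_preimage_translate (measurable_periodized c e). Qed.

End Periodization.

(** * Uniqueness of the invariant measure *)

Lemma probability1_setI (R : realType) (disp : measure_display)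
    (T : measurableType disp) (P : probability T R) (A B : set T) :
  measurable A -> measurable B -> P A = 1%E -> P (A `&` B) = P B.
Proof.
move=> mA mB PA; rewrite [RHS](measureDI P mB mA) setIC.
rewrite -[LHS]add0e; congr (_ + _)%E; apply/esym.
 apply/eqP; rewrite eq_le measure_ge0 andbT.
have : P (~` A) = 0%E by rewrite probability_setC// PA -EFinB subrr.
move=> <-; apply: le_measure; rewrite ?inE; [exact: measurableD|exact: measurableC|].
by move=> t [].
Qed.

Lemma product_measure12 (R : realType) (d1 d2 : measure_display)
    (T1 : measurableType d1) (T2 : measurableType d2)
    (m1 : {sigma_finite_measure set T1 -> \bar R})
    (m2 : {sigma_finite_measure set T2 -> \bar R}) (A : set (T1 * T2)) :
  measurable A -> (m1 \x m2)%E A = (m1 \x^ m2)%E A.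
Proof. by apply: product_measure_unique => B C mB mC /=; rewrite product_measure2E. Qed.

Section Uniqueness.
Context (R : realType) (d : nat) (L : {fset 'rV[int]_d}) (a : R).
Hypotheses (d_ge1 : (1 <= d)%N) (L_neq0 : L != fset0).
Hypotheses (a_gt0 : 0 < a) (a_irr : irrational a).
Local Notation X := (config R L).
Local Notation n := #|{: L}|.
Local Notation ilap v := (lap (fun z : L => (v z : int)%:~R : R)).
Implicit Types (eta zeta : X) (nu mu : probability X R) (c g : L -> R).
Implicit Types (e delta : R) (s : seq L).

Let a_ge0 : 0 <= a. Proof. exact: ltW. Qed.

Let mS c e g := @measurable_shifted R d L c e g.

Lemma shifted_mass_le1 nu c e g : shifted_mass nu c e g <= 1.
Proof. by exact: fine_measure_le1. Qed.

Lemma shifted_mass_ge0 nu c e g : 0 <= shifted_mass nu c e g.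
Proof. by rewrite /shifted_mass fine_ge0. Qed.

Lemma shifted_mass_harmonic nu c e g : invariant_probability a nu ->
  shifted_mass nu c e g =
  n%:R^-1 * \sum_x shifted_mass nu c e (fun y => g y + deposit a x y).
Proof.
move=> inv; have [nuO _] := inv; have mO := @measurable_Omega R d L.
rewrite /shifted_mass -(probability1_setI mO (mS c e g) nuO).
rewrite (invariant_fine d_ge1 a_gt0 inv); last 2 first.
- exact: measurableI.
- exact: subIsetl.
congr (_ * _); apply: eq_bigr => x _.
rewrite -[in RHS](probability1_setI mO (mS c e _) nuO); congr (fine (nu _)).
apply/seteqP; split=> eta /= [Oe];
  have [H1 H2] := periodized_add_op d_ge1 c e g x a_ge0 Oe.
  by move=> [_ /H1].
move=> /H2 per; split=> //; split=> //.
by have [s []] := add_opP d_ge1 x a_ge0 Oe.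
Qed.

(** By harmonicity the defect [S - shifted_mass] at [g] is the average of [n] nonnegative defects,
    so each of these is at most [n] times as large; iterate along the word. *)
Lemma shifted_mass_word nu c e g (S : R) s : invariant_probability a nu ->
  (forall h, shifted_mass nu c e h <= S) ->
  S - shifted_mass nu c e (fun y => g y + a * (count_mem y s)%:R) <=
  n%:R ^+ size s * (S - shifted_mass nu c e g).
Proof.
move=> inv uS; elim: s g => [|x s IH] g.
  by rewrite expr0 mul1r (_ : (fun y => _) = g)//; apply/funext => y; rewrite mulr0 addr0.
have n0 : 0 < n%:R :> R by rewrite ltr0n card_sites_gt0.
rewrite (_ : (fun y => _) =
    (fun y => (fun z => g z + deposit a x z) y + a * (count_mem y s)%:R)).
  apply: le_trans (IH _) _; rewrite /= exprSr -mulrA ler_wpM2l// ?exprn_ge0//.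
  rewrite [in leRHS](shifted_mass_harmonic c e g inv) mulrBr mulrA divff ?gt_eqF// mul1r.
  rewrite mulr_natl -sumr_const -sumrB (bigD1 x)//= lerDl.
  by apply: sumr_ge0 => y _; rewrite subr_ge0.
by apply/funext => y /=; rewrite natrD mulrDr addrA /deposit (eq_sym y).
Qed.

Lemma shifted_mass_near nu c e delta g g' (v : L -> int) :
  (forall y, `|g y - g' y - ilap v y| <= delta) ->
  shifted_mass nu c e g <= shifted_mass nu c (e + delta) g'.
Proof.
move=> near; apply: (@fine_measure_le R d L) => // eta /=.
have [_ H] := periodized_ilap c e (fun x => - v x) (translate g eta).
move=> /H; apply: periodized_near => y.
rewrite !height_translate -normrN; apply: le_trans (near y).
rewrite le_eqVlt; apply/orP; left; apply/eqP; congr (`|_|).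
have -> : lap (fun z => (- v z)%:~R) y = - ilap v y.
  by rewrite -lapN; congr (lap _ y); apply/funext => z; rewrite rmorphN.
by ring.
Qed.

Definition word_of (k : L -> nat) : seq L :=
  flatten [seq nseq (k x) x | x <- index_enum L].

Lemma count_word_of k y : count_mem y (word_of k) = k y.
Proof.
rewrite /word_of count_flatten sumnE !big_map (bigD1 y)//=.
rewrite count_nseq /= eqxx mul1n big1 ?addn0// => x xy.
by rewrite count_nseq/= (negbTE xy).
Qed.

Lemma size_word_of k m : (forall x, k x <= m)%N -> (size (word_of k) <= n * m)%N.
Proof.
move=> km; rewrite /word_of size_flatten /shape sumnE !big_map.
rewrite -sum_nat_const; apply: leq_sum => x _; by rewrite size_nseq.
Qed.

(* Near-maximality of the mass propagates along the walk, which comes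
   [delta]-close to every point modulo the lattice within a bounded number of
   steps. *)
Lemma shifted_mass_flat nu c e delta g g' : invariant_probability a nu ->
  0 < delta -> shifted_mass nu c e g <= shifted_mass nu c (e + delta) g'.
Proof.
move=> inv delta0; rewrite leNgt; apply/negP => lt.
pose E := [set shifted_mass nu c e h | h in [set: L -> R]].
have E_sup : has_sup E.
  split; first by exists (shifted_mass nu c e g), g.
  by exists 1 => _ [h _ <-]; exact: shifted_mass_le1.
set S := sup E.
have uS h : shifted_mass nu c e h <= S.
  by apply: sup_upper_bound => //; exists h.
have [D D0 DP] := lattice_period R L d_ge1.
have [V VP] := choice DP.
have [m mP] := kronecker a_irr D0 delta0.
have n1 : 1 <= n%:R :> R by rewrite ler1n card_sites_gt0.
have n0 : 0 < n%:R ^+ (n * m) :> R by rewrite exprn_gt0// (lt_le_trans _ n1).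
pose gap := S - shifted_mass nu c (e + delta) g'.
have gap0 : 0 < gap by rewrite subr_gt0 (lt_le_trans lt).
(* A walk of at most [n * m] steps inflates the defect by at most [n ^ (n * m)]. Starting this close
   to the supremum leaves a defect of at most [gap / 2] at its end, which lies within [delta] of
   [g'] modulo the lattice. *)
have [_ [h _ <-] hS] : exists2 u, E u & S - gap / (2 * n%:R ^+ (n * m)) < u.
  by apply: sup_adherent => //; rewrite divr_gt0// mulr_gt0.
have /choice[k kP] : forall x, exists k : nat, (k <= m)%N /\
    exists j : int, `|a * k%:R - (g' x - h x) - D%:R * j%:~R| <= delta.
  by move=> x; have [k km [j jP]] := mP (g' x - h x); exists k; split=> //; exists j.
have /choice[j jP] : forall x, exists j : int,
    `|a * (k x)%:R - (g' x - h x) - D%:R * j%:~R| <= delta.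
  by move=> x; have [] := kP x.
have := shifted_mass_word h (word_of k) inv uS.
have : shifted_mass nu c e (fun y => h y + a * (count_mem y (word_of k))%:R) <=
    shifted_mass nu c (e + delta) g'.
  (* [V x] has Laplacian [D] at [x] and 0 elsewhere, so this integer combination realizes [D * j] as
     a lattice vector. *)
  apply: (@shifted_mass_near _ _ _ _ _ _ (fun z => \sum_x j x * V x z)) => y.
  rewrite count_word_of.
  have -> : ilap (fun z => \sum_x j x * V x z) y = D%:R * (j y)%:~R.
    apply: (@etrans _ _ (\sum_x (j x)%:~R * ilap (V x) y)).
      rewrite (eq_bigr _ (fun x _ => esym (lapZ _ _ _))) -lap_sum.
      congr (lap _ y); apply/funext => z; rewrite rmorph_sum.
      by apply: eq_bigr => x _; rewrite rmorphM.
    rewrite (bigD1 y)//= big1 => [|x xy]; last first.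
      by rewrite VP eq_sym (negbTE xy) !mulr0.
    by rewrite VP eqxx addr0 mulr1 mulrC.
  by apply: le_trans (jP y); rewrite le_eqVlt; apply/orP; left; apply/eqP; congr `|_|; ring.
have : n%:R ^+ size (word_of k) * (S - shifted_mass nu c e h) <= gap / 2.
  apply: le_trans (_ : n%:R ^+ (n * m) * (gap / (2 * n%:R ^+ (n * m))) <= _).
    apply: ler_pM; rewrite ?exprn_ge0// ?subr_ge0//.
      apply: ler_weXn2l => //; apply: size_word_of => x; by have [] := kP x.
    by rewrite lerBlDr addrC -lerBlDr ltW.
  by rewrite invfM mulrCA (mulrCA (n%:R ^+ _)) divff ?gt_eqF// mulr1.
move=> le1 le2 le3.
have : gap <= gap / 2 by apply: le_trans (le_trans le3 le1); rewrite lerD2l lerN2.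
by rewrite leNgt ltr_pdivrMr// ltr_pMr// ltr1n.
Qed.

Lemma measurable_height_translate c e :
  measurable [set p : X * X | periodized c e (translate (height p.1) p.2)].
Proof.
have mf : measurable_fun setT (fun p : X * X => translate (height p.1) p.2).
  apply: measurable_mkconfig => x; apply: measurable_funD.
    exact: measurableT_comp (@measurable_height R d L x) measurable_snd.
  exact: measurableT_comp (@measurable_height R d L x) measurable_fst.
rewrite -[X in measurable X]setTI; apply: mf => //.
exact: measurable_periodized.
Qed.

(** Translating [eta] by the heights of [zeta] or [zeta] by those of [eta] gives the same sum. The
    product mass of the pairs whose sum is in [periodized c e] is thus at least [r] by [nu]-sections
    and at most [r'] by [mu]-sections. *)
Lemma shifted_mass_exchange nu mu c e (r r' : R) : 0 <= r ->
  (forall g, r <= shifted_mass nu c e g) ->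
  (forall g, shifted_mass mu c e g <= r') -> r <= r'.
Proof.
move=> r0 nur mur.
pose A := [set p : X * X | periodized c e (translate (height p.1) p.2)].
have mA : measurable A := measurable_height_translate c e.
have := product_measure12 mu nu mA.
rewrite /product_measure1 /product_measure2 => AE.
rewrite -lee_fin; apply: (@le_trans _ _ (\int[mu]_x (nu \o xsection A) x)%E).
  rewrite -[leLHS]mule1 -(probability_setT mu) -integral_cst//.
  apply: ge0_le_integral => //; first exact: measurable_fun_xsection.
  move=> zeta _; rewrite /= -[leRHS]fineK; last first.
    by apply: fin_num_measure; exact: measurable_xsection.
  rewrite lee_fin; apply: le_trans (nur (height zeta)) _.
  rewrite /shifted_mass le_eqVlt; apply/orP; left; apply/eqP; congr (fine (nu _)).
  by apply/seteqP; split=> eta; rewrite /xsection/= inE.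
rewrite AE -[leRHS]mule1 -(probability_setT nu) -integral_cst//.
apply: ge0_le_integral => //; first exact: measurable_fun_ysection.
move=> eta _; rewrite /= -[leLHS]fineK; last first.
  by apply: fin_num_measure; exact: measurable_ysection.
rewrite lee_fin; apply: le_trans _ (mur (height eta)).
rewrite /shifted_mass le_eqVlt; apply/orP; left; apply/eqP; congr (fine (mu _)).
apply/seteqP; split=> zeta; rewrite /ysection/= inE /A/=.
  by rewrite (_ : translate _ eta = translate (height eta) zeta)//;
    apply: height_inj => x; rewrite !height_translate addrC.
by rewrite (_ : translate _ zeta = translate (height zeta) eta)//;
  apply: height_inj => x; rewrite !height_translate addrC.
Qed.

Lemma shifted_mass_le nu mu c e delta g g' : invariant_probability a nu ->
  invariant_probability a mu -> 0 < delta ->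
  shifted_mass nu c e g <= shifted_mass mu c (e + delta) g'.
Proof.
move=> inv inv' delta0.
(* Half of [delta] is spent on the flatness of [nu], half on that of [mu]. *)
apply: (@shifted_mass_exchange nu mu c (e + delta / 2)) => [|h|h].
- exact: shifted_mass_ge0.
- by apply: shifted_mass_flat => //; rewrite divr_gt0.
- have -> : e + delta = e + delta / 2 + delta / 2 by field.
  by apply: shifted_mass_flat => //; rewrite divr_gt0.
Qed.

(** Compare slack 0 under [nu] with slack [k.+1%:R^-1] under [mu], then let [k] grow and use
    continuity from above. *)
Lemma allowed_below_le nu mu c : invariant_probability a nu ->
  invariant_probability a mu -> (forall x, c x < 1) ->
  (nu (allowed R L `&` [set eta | forall x, (height eta x <= c x)%R]) <=
   mu (allowed R L `&` [set eta | forall x, (height eta x <= c x)%R]))%E.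
Proof.
move=> inv inv' c1; set K := _ `&` _.
have mA := @measurable_allowed R d L.
have mK : measurable K.
  by apply: measurableI => //; apply: measurable_forall_fin => x; exact: measurable_height_le.
pose F (k : nat) : set X := allowed R L `&` periodized c k.+1%:R^-1.
have mF k : measurable (F k) by apply: measurableI => //; exact: measurable_periodized.
have mUF : measurable (\bigcap_k F k) by exact: bigcapT_measurable.
have ndF : {homo F : n m / (n <= m)%N >-> (m <= n)%O}.
  move=> i j ij; apply/subsetPset => eta [Ae per]; split=> //.
  have -> : i.+1%:R^-1 = j.+1%:R^-1 + (i.+1%:R^-1 - j.+1%:R^-1) :> R by rewrite addrC subrK.
  apply: periodized_near per => x; rewrite subrr normr0 subr_ge0.
  by rewrite lef_pV2 ?posrE ?ltr0n// ler_nat.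
have cF : mu (F k) @[k --> \oo] --> mu (\bigcap_k F k).
  by apply: nonincreasing_cvg_mu => //; rewrite ltey_eq fin_num_measure.
apply: (@le_trans _ _ (mu (\bigcap_k F k))).
  rewrite -(cvg_lim _ cF)//; apply: lime_ge; first by apply/cvg_ex; eexists; exact: cF.
  apply: nearW => k.
  rewrite /F (probability1_setI mA (measurable_periodized c _)); last first.
    exact: (invariant_allowed d_ge1 L_neq0 a_gt0 inv').
  have t0 e : translate (fun=> 0) @^-1` periodized c e = periodized c e.
    by apply/seteqP; split=> eta /=; rewrite translate0.
  rewrite -[leRHS]fineK ?fin_num_measure//; last exact: measurable_periodized.
  rewrite -[leLHS]fineK ?fin_num_measure// lee_fin.
  have := @shifted_mass_le nu mu c 0 k.+1%:R^-1 (fun=> 0) (fun=> 0) inv inv' _.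
  rewrite add0r /shifted_mass !t0 invr_gt0 ltr0n => /(_ isT); apply: le_trans.
  apply: fine_measure_le => //; first exact: measurable_periodized.
  by move=> eta [Ae ec]; exact: periodized_allowed.
apply: le_measure; rewrite ?inE// => eta FE; split; first by case: (FE 0%N Logic.I).
apply: (allowed_periodized d_ge1 c1) => [|k]; first by case: (FE 0%N Logic.I).
by case: (FE k Logic.I).
Qed.

Definition orthant (b : L -> R) : set X := [set eta | forall x, height eta x < b x].

Lemma measurable_orthant b : measurable (orthant b).
Proof. by apply: measurable_forall_fin => x; exact: measurable_height_lt. Qed.

Lemma orthant_le nu mu b : invariant_probability a nu ->
  invariant_probability a mu -> (nu (orthant b) <= mu (orthant b))%E.
Proof.
move=> inv inv'.
have mA := @measurable_allowed R d L; have mO := measurable_orthant b.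
have nuA := invariant_allowed d_ge1 L_neq0 a_gt0 inv.
have muA := invariant_allowed d_ge1 L_neq0 a_gt0 inv'.
rewrite -(probability1_setI mA mO nuA) -(probability1_setI mA mO muA).
(* Truncating at 1 loses nothing on allowed configurations and keeps [c k] strictly below 1; the
   closed boxes increase to the open orthant. *)
pose c (k : nat) x := Order.min (b x) 1 - k.+1%:R^-1.
have c_lt k x : c k x < Order.min (b x) 1 by rewrite /c ltrBlDr ltrDl invr_gt0.
pose G k := allowed R L `&` [set eta | forall x, height eta x <= c k x].
have mG k : measurable (G k).
  by apply: measurableI => //; apply: measurable_forall_fin => x; exact: measurable_height_le.
have UG : \bigcup_k G k = allowed R L `&` orthant b.
  apply/seteqP; split=> eta => [[k _ [Ae le]]|[Ae lt]].
    split=> // x; have /lt_le_trans := le_lt_trans (le x) (c_lt k x); apply.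
    by rewrite ge_min lexx.
  have [|k kP] := @inv_nat_le_fin R L (fun x => Order.min (b x) 1 - height eta x).
    by move=> x; rewrite subr_gt0 lt_min lt; have [/(_ x)/andP[]] := Ae.
  by exists k => //; split=> // x; have := kP x; rewrite /c !lerBrDr addrC.
have ndG : {homo G : n m / (n <= m)%N >-> (n <= m)%O}.
  move=> i j ij; apply/subsetPset => eta [Ae le]; split=> // x.
  by apply: le_trans (le x) _; rewrite lerD2l lerN2 lef_pV2 ?posrE ?ltr0n// ler_nat.
have cG : nu (G k) @[k --> \oo] --> nu (\bigcup_k G k).
  by apply: nondecreasing_cvg_mu => //; exact: bigcupT_measurable.
rewrite -UG -(cvg_lim _ cG)//; apply: lime_le; first by apply/cvg_ex; eexists; exact: cG.
apply: nearW => k; apply: (@le_trans _ _ (mu (G k))).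
  apply: allowed_below_le => // x; apply: lt_le_trans (c_lt k x) _.
  by rewrite ge_min lexx orbT.
apply: le_measure; rewrite ?inE//; first exact: bigcupT_measurable.
exact: bigcup_sup.
Qed.

Lemma measurable_orthantE : @measurable _ X = <<s range orthant >>.
Proof.
apply/seteqP; split=> B; last first.
  apply: smallest_sub; first exact: sigma_algebra_measurable.
  by move=> _ [b _ <-]; exact: measurable_orthant.
have sub i A : measurable A -> <<s range orthant >> ((fun eta : X => tnth eta i) @^-1` A).
  move=> mA; have {}mA : <<s @RGenInftyO.G R >> A.
    exact: (eq_ind _ (fun M : set (set R) => M A) mA _ (RGenInftyO.measurableE R)).
  suff : image_set_system setT (fun eta : X => tnth eta i) <<s range orthant >> A.
    by rewrite /image_set_system /= setTI.
  apply: mA; split; first exact/sigma_algebra_image/smallest_sigma_algebra.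
  move=> _ [r ->]; rewrite /image_set_system /= setTI.
  (* Coordinate [i] is bounded by [r], while the bounds [k] on the others are removed in the
     countable union. *)
  pose b (k : nat) y := if y == enum_val i then r else k%:R.
  rewrite (_ : _ @^-1` _ = \bigcup_k orthant (b k)); last first.
    apply/seteqP; split=> eta /=; rewrite in_itv/=.
      move=> ir; exists (\sum_x (Num.truncn (height eta x)).+1)%N => // x.
      rewrite /b; case: eqP => [->|_]; first by rewrite /height enum_valK.
      apply: lt_le_trans (truncnS_gt _) _; rewrite ler_nat (bigD1 x)//=.
      exact: leq_addr.
    by move=> [k _ /(_ (enum_val i))]; rewrite /b eqxx /height enum_valK.
  by apply: sigma_algebra_bigcup => k; apply: sub_sigma_algebra; exists (b k).
apply; split; first exact: smallest_sigma_algebra.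
by rewrite -bigcup_seq => A [i _ [C mC <-]]; rewrite setTI; exact: sub.
Qed.

Lemma invariant_unique nu mu : invariant_probability a nu ->
  invariant_probability a mu -> forall B, measurable B -> nu B = mu B.
Proof.
move=> inv inv'; apply: (measure_unique (range orthant)
  (fun k : nat => orthant (fun=> k%:R))).
- exact: measurable_orthantE.
- move=> _ _ [b _ <-] [b' _ <-]; exists (fun x => Order.min (b x) (b' x)) => //.
  apply/seteqP; split=> eta /=.
    by move=> H; split=> x; have := H x; rewrite lt_min => /andP[].
  by move=> [H H'] x; rewrite lt_min H H'.
- by move=> k; exists (fun=> k%:R).
- apply/seteqP; split=> // eta _.
  exists (\sum_x (Num.truncn (height eta x)).+1)%N => // x.
  apply: lt_le_trans (truncnS_gt _) _; rewrite ler_nat (bigD1 x)//=.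
  exact: leq_addr.
- by move=> _ [b _ <-]; apply/eqP; rewrite eq_le !orthant_le.
- by move=> k; rewrite ltey_eq fin_num_measure//; exact: measurable_orthant.
Qed.

End Uniqueness.

(** * Ergodicity *)

Section Ergodicity.
Context (R : realType) (disp : measure_display) (T : measurableType disp).
Variable P : probability T R.

(** The constant is the threshold at which the distribution function of [h] jumps from 0 to 1. *)
Lemma zero_one_constant (h : T -> R) (M : R) : measurable_fun setT h ->
  (forall t, `|h t| <= M) ->
  (forall r, P [set t | h t < r] = 0%E \/ P [set t | h t < r] = 1%E) ->
  exists c, {ae P, forall t, h t = c}.
Proof.
move=> mh hM h01.
have mE r : measurable [set t | h t < r].
  rewrite (_ : [set t | _] = h @^-1` `]-oo, r[).
    by rewrite -[X in measurable X]setTI; exact: mh.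
  by apply/seteqP; split=> t /=; rewrite in_itv.
pose Z := [set r | P [set t | h t < r] = 0%E].
have Zsup : has_sup Z.
  split.
    exists (- M); rewrite /Z /= (_ : [set t | _] = set0) ?measure0//.
    apply/seteqP; split=> // t /=; rewrite ltNge => /negP; apply.
    by have := hM t; rewrite ler_norml => /andP[].
  exists (M + 1) => r Zr; rewrite leNgt; apply/negP => rM.
  move: Zr; rewrite /Z /= (_ : [set t | _] = setT) ?probability_setT//.
    by move=> /eqP; rewrite onee_eq0.
  apply/seteqP; split=> // t _ /=; apply: le_lt_trans rM.
  by have := hM t; rewrite ler_norml => /andP[_ /le_trans]; apply; rewrite lerDl.
exists (sup Z).
have below_sup r : r < sup Z -> P [set t | h t < r] = 0%E.
  rewrite -subr_gt0 => rZ; have [s Zs] := sup_adherent rZ Zsup.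
  rewrite opprB addrC subrK => rs; apply/eqP; rewrite eq_le measure_ge0 andbT.
  rewrite -Zs; apply: le_measure; rewrite ?inE; [exact: mE|exact: mE|].
  by move=> t /= /lt_trans; exact.
have above_sup r : sup Z < r -> P [set t | h t < r] = 1%E.
  case: (h01 r) => // Zr; rewrite ltNge => /negP; case.
  exact: sup_upper_bound.
have /ae_foralln ge_sup : forall k, {ae P, forall t, sup Z - k.+1%:R^-1 <= h t}.
  move=> k; exists [set t | h t < sup Z - k.+1%:R^-1]; split=> //.
    by apply: below_sup; rewrite ltrBlDr ltrDl invr_gt0.
  by move=> t /= /negP; rewrite -ltNge.
have /ae_foralln lt_sup : forall k, {ae P, forall t, h t < sup Z + k.+1%:R^-1}.
  move=> k; exists (~` [set t | h t < sup Z + k.+1%:R^-1]); split=> //.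
    exact: measurableC.
  by rewrite probability_setC// above_sup ?ltrDl ?invr_gt0// -EFinB subrr.
apply: filterS2 ge_sup lt_sup => t ge_t lt_t; apply/eqP; rewrite eq_le.
by apply/andP; split; apply/ler_addgt0Pr => e e0;
  have [//|k /(_ tt) ke] := @inv_nat_le_fin R unit (fun=> e);
  have := ge_t k; have := lt_t k; move: ke; set z := k.+1%:R^-1; lra.
Qed.

(** The functions [h \o tau i] have the same L2 norm as [h], and their average is [h]; strict
    convexity forces them to coincide with it. The bound [M] keeps the integrals finite, so that
    they can be cancelled. *)
Lemma harmonic_invariant (I : finType) (tau : I -> T -> T) (h : T -> R) (M : R) :
  (forall i, measurable_fun setT (tau i)) ->
  (forall i B, measurable B -> P (tau i @^-1` B) = P B) ->
  measurable_fun setT h -> (forall t, 0 <= h t <= M) ->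
  {ae P, forall t, \sum_i h (tau i t) = #|I|%:R * h t} ->
  {ae P, forall t, forall i, h (tau i t) = h t}.
Proof.
move=> mtau Ptau mh hM harm.
have mht i : measurable_fun setT (h \o tau i) by exact: measurableT_comp.
have msq (f : T -> R) : measurable_fun setT f ->
    measurable_fun setT (fun t => (f t ^+ 2)%:E).
  by move=> mf; apply/measurable_EFinP; exact: measurable_funX.
(* Expanding the squares, [D + #|I| h^2 = \sum_i (h \o tau i)^2] a.e., and both
   sides have the same integral once [D] is dropped. *)
pose D t := (\sum_i ((h (tau i t) - h t) ^+ 2)%:E)%E.
have mD : measurable_fun setT D.
  by apply: emeasurable_sum => i; exact: (msq (h \o tau i \- h) (measurable_funB _ _)).
have D_ge0 t : (0 <= D t)%E by apply: sume_ge0 => i _; rewrite lee_fin sqr_ge0.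
pose K := (\sum_(i : I) \int[P]_t (h t ^+ 2)%:E)%E.
have K_fin : K \is a fin_num.
  apply/sum_fin_numP => i _ _; rewrite ge0_fin_numE; last first.
    by apply: integral_ge0 => t _; rewrite lee_fin sqr_ge0.
  apply: (@le_lt_trans _ _ (\int[P]_t (M ^+ 2)%:E)%E).
    apply: ge0_le_integral => //; first by move=> t _; rewrite lee_fin sqr_ge0.
      exact: msq.
    move=> t _; rewrite lee_fin; have /andP[h0 hle] := hM t.
    by rewrite ler_sqr ?nnegrE// (le_trans h0 hle).
  by rewrite integral_cst// [X in (_ * X)%E](probability_setT P) mule1 ltry.
have sq_tau i : (\int[P]_t (h (tau i t) ^+ 2)%:E = \int[P]_t (h t ^+ 2)%:E)%E.
  have := @ge0_integral_pushforward _ _ T T R (tau i) (mtau i) P setT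
    (fun t => (h t ^+ 2)%:E) measurableT (msq _ mh) _.
  rewrite preimage_setT => <-; last by move=> t _; rewrite lee_fin sqr_ge0.
  apply: (@eq_measure_integral _ _ _ _ P
    (measure_function_pushforward__canonical__measure_function_Measure P (mtau i))).
  by move=> A mA _; exact: Ptau.
have D0 : (\int[P]_t D t = 0)%E.
  have : (\int[P]_t (D t + \sum_(i : I) (h t ^+ 2)%:E) =
      \int[P]_t (\sum_(i : I) (h (tau i t) ^+ 2)%:E))%E.
    apply: ae_eq_integral => //.
    - by apply: emeasurable_funD => //; apply: emeasurable_sum => i; exact: msq.
    - by apply: emeasurable_sum => i; exact: (msq (h \o tau i)).
    apply: filterS harm => t ht _; rewrite /D !sumEFin -EFinD; congr (_%:E).
    rewrite (eq_bigr (fun i => (h (tau i t) ^+ 2 - 2 * h t * h (tau i t)) + h t ^+ 2)).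
      rewrite big_split sumrB/= -mulr_sumr ht sumr_const -mulr_natl; ring.
    by move=> i _; ring.
  rewrite ge0_integralD//; last 2 first.
  - by move=> t _; apply: sume_ge0 => i _; rewrite lee_fin sqr_ge0.
  - by apply: emeasurable_sum => i; exact: msq.
  rewrite [X in (_ + X)%E](_ : _ = K); last first.
    rewrite ge0_integral_sum// => [i|i t _]; [exact: msq|by rewrite lee_fin sqr_ge0].
  rewrite [RHS](_ : _ = K); last first.
    rewrite ge0_integral_sum// => [|i|i t _].
    - by apply: eq_bigr => i _; exact: sq_tau.
    - exact: (msq (h \o tau i)).
    - by rewrite lee_fin sqr_ge0.
  by move=> /(congr1 (fun z => z - K)%E); rewrite addeK// subee.
have /(ae_eq_integral_abs P measurableT mD) : (\int[P]_t `|D t| = 0)%E.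
  by rewrite -[RHS]D0; apply: eq_integral => t _; rewrite gee0_abs.
apply: filterS => t /(_ Logic.I) /eqP; rewrite /D sumEFin /= eqe => Dt0 i.
apply/eqP; rewrite -subr_eq0 -sqrf_eq0.
move: Dt0; rewrite psumr_eq0 => [/allP/(_ i (mem_index_enum _))//|j _].
exact: sqr_ge0.
Qed.

End Ergodicity.

(** * The normalized volume: existence, invariance and ergodicity *)

Section Main.
Context (R : realType) (d : nat) (L : {fset 'rV[int]_d}) (a : R).
Hypotheses (d_ge1 : (1 <= d)%N) (L_neq0 : L != fset0).
Hypotheses (a_gt0 : 0 < a) (a_irr : irrational a).
Local Notation X := (config R L).
Local Notation n := #|{: L}|.
Implicit Types (eta : X) (mu nu : probability X R).

Let a_ge0 : 0 <= a. Proof. exact: ltW. Qed.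

Lemma normalized_volume_exists : exists mu, @normalized_volume R d L mu.
Proof.
have [m mE] := vol_sigma_finite R n.
have mA := @measurable_allowed R d L.
have := vol_allowed_gt0 R L d_ge1; have := vol_allowed_le1 R L.
rewrite -/n mE => mA1 mA0.
have [||mu muE] := normalized_restriction mA (_ : m _ \is a fin_num) (_ : m _ != 0%E).
- by rewrite ge0_fin_numE// (le_lt_trans mA1) ?ltry.
- by rewrite gt_eqF.
by exists mu => B mB; rewrite /normalized_volume -/n mE muE.
Qed.

Lemma normalized_volume_allowed mu : normalized_volume mu -> mu (allowed R L) = 1%E.
Proof.
move=> vmu; rewrite vmu; last exact: measurable_allowed.
have v0 := vol_allowed_gt0 R L d_ge1; have v1 := vol_allowed_le1 R L.
rewrite setIid divff// gt_eqF// fine_gt0// v0 (le_lt_trans v1) ?ltry//.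
Qed.

Lemma normalized_volume_add_op mu x (B : set X) : normalized_volume mu ->
  measurable B -> mu (Omega R L `&` add_op a x @^-1` B) = mu B.
Proof.
move=> vmu mB; rewrite !vmu//; last exact: measurable_preimage_add_op.
rewrite [B `&` _]setIC -(vol_allowed_add_op d_ge1 x a_ge0 mB).
congr ((fine (vol _) / _)%:E); apply/seteqP; split=> eta /=.
  by move=> [[_ ?] ?].
by move=> [[Oe H] ?].
Qed.

Lemma invariant_of_preserved nu : nu (Omega R L) = 1%E ->
  (forall x (B : set X), measurable B ->
     nu (Omega R L `&` add_op a x @^-1` B) = nu B) -> invariant_probability a nu.
Proof.
move=> nuO H; split=> // B mB _.
rewrite (eq_bigr (fun=> nu B)) => [|x _]; last exact: H.
rewrite -[nu B]fineK ?fin_num_measure// sumEFin -EFinM; congr (_%:E).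
rewrite sumr_const -[X in _ = _ * X]mulr_natl mulrA mulVf ?mul1r//.
by rewrite pnatr_eq0 -lt0n card_sites_gt0.
Qed.

Lemma allowed_sub_Omega mu : mu (allowed R L) = 1%E -> mu (Omega R L) = 1%E.
Proof.
move=> muA; rewrite -(probability1_setI _ _ muA); [|exact: measurable_allowed|exact: measurable_Omega].
by rewrite (_ : _ `&` _ = allowed R L)//; apply/seteqP; split=> eta [].
Qed.

Lemma normalized_volume_invariant mu : normalized_volume mu ->
  invariant_probability a mu.
Proof.
move=> vmu; apply: invariant_of_preserved => [|x B mB].
  exact/allowed_sub_Omega/normalized_volume_allowed.
exact: normalized_volume_add_op.
Qed.

(* The identity off allowed configurations makes the map measurable everywhere. *)
Definition allowed_step x eta : X :=
  if pselect (allowed R L eta) then add_op a x eta else eta.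

Lemma allowed_stepE x eta : allowed R L eta -> allowed_step x eta = add_op a x eta.
Proof. by rewrite /allowed_step; case: pselect. Qed.

Lemma preimage_allowed_step x (B : set X) : allowed_step x @^-1` B =
  (allowed R L `&` (Omega R L `&` add_op a x @^-1` B)) `|` (~` allowed R L `&` B).
Proof.
apply/seteqP; split=> eta; rewrite /allowed_step /preimage /=.
  by case: pselect => Ae Be; [left; split=> //; split=> //; case: (Ae)|right].
by case: pselect => Ae [[? []]|[]].
Qed.

Lemma measurable_allowed_step x : measurable_fun setT (allowed_step x).
Proof.
have mA := @measurable_allowed R d L.
move=> _ B mB; rewrite setTI preimage_allowed_step; apply: measurableU.
  by apply: measurableI => //; exact: measurable_preimage_add_op.
by apply: measurableI => //; exact: measurableC.
Qed.

Lemma normalized_volume_step mu x (B : set X) : normalized_volume mu ->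
  measurable B -> mu (allowed_step x @^-1` B) = mu B.
Proof.
move=> vmu mB; have muA := normalized_volume_allowed vmu.
have mA := @measurable_allowed R d L.
rewrite -[RHS](normalized_volume_add_op x vmu mB).
rewrite -(probability1_setI mA _ muA); last first.
  by rewrite -[X in measurable X]setTI; exact: measurable_allowed_step.
rewrite -[RHS](probability1_setI mA _ muA); last exact: measurable_preimage_add_op.
congr (mu _); rewrite preimage_allowed_step.
by apply/seteqP; split=> eta /= [Ae]; [move=> [[]|[]]|move=> ?; split=> //; left].
Qed.

(** If [mu E] is nonzero, conditioning on [E] gives an invariant measure, equal to [mu] by
    uniqueness; it gives [E] mass 1. The full-mass set [G] is there because level sets of an
    invariant function are stable only off a null set. *)
Lemma normalized_volume_zero_one mu (E G : set X) : normalized_volume mu ->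
  measurable E -> measurable G -> mu G = 1%E ->
  (forall eta x, G eta -> (E (add_op a x eta) <-> E eta)) ->
  mu E = 0%E \/ mu E = 1%E.
Proof.
move=> vmu mE mG muG GE; have [|E0] := eqVneq (mu E) 0%E; [by left|right].
have Efin : mu E \is a fin_num by exact: fin_num_measure.
have [nu] := normalized_restriction mE Efin E0.
pose ratio B := (fine (mu (B `&` E)) / fine (mu E))%:E.
rewrite -[X in X -> _]/(forall B, measurable B -> nu B = ratio B) => nuE.
have mO := @measurable_Omega R d L.
have fE0 : fine (mu E) != 0 by rewrite fine_eq0.
have muO : mu (Omega R L) = 1%E.
  exact/allowed_sub_Omega/normalized_volume_allowed.
have inv : invariant_probability a nu.
  apply: invariant_of_preserved => [|x B mB].
    by rewrite nuE// /ratio (probability1_setI mO mE muO) divff.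
  have mB' := measurable_preimage_add_op d_ge1 x a_ge0 mB.
  rewrite !nuE// /ratio; congr ((fine _ / _)%:E).
  have mBE : measurable (B `&` E) by exact: measurableI.
  rewrite -[RHS](normalized_volume_add_op x vmu mBE).
  rewrite -(probability1_setI mG _ muG); last exact: measurableI.
  rewrite -[RHS](probability1_setI mG _ muG); last exact: measurable_preimage_add_op.
  congr (mu _); apply/seteqP; split=> eta /= [Ge]; have := GE eta x Ge; tauto.
have inv' := normalized_volume_invariant vmu.
rewrite -(invariant_unique d_ge1 L_neq0 a_gt0 a_irr inv inv' mE) nuE// /ratio.
by rewrite setIid divff.
Qed.

Lemma normalized_volume_ergodic mu : normalized_volume mu -> ergodic a mu.
Proof.
move=> vmu; have muA := normalized_volume_allowed vmu.
have mA := @measurable_allowed R d L.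
split=> [||g [mg [M gM] harm]]; [exact: normalized_volume_invariant|by []|].
(* Adding [M] makes the function nonnegative, and extending it by 0 makes it harmonic for
   [allowed_step] off the allowed set too. *)
pose h : X -> R := (fun eta => g eta + M) \_ (allowed R L).
have hE eta : allowed R L eta -> h eta = g eta + M by move=> Ae; rewrite /h patchE mem_set.
have hN eta : ~ allowed R L eta -> h eta = 0 by move=> Ae; rewrite /h patchE memNset.
have mh : measurable_fun setT h.
  exact: ((measurable_restrictT _ mA).1 (measurable_funD mg (measurable_cst M))).
have h_itv eta : 0 <= h eta <= M + M.
  have [Ae|Ae] := pselect (allowed R L eta).
    by rewrite hE//; have := gM _ Ae; rewrite ler_norml => /andP[]; lra.
  (* The bound [M] is known to be nonnegative only through some allowed configuration. *)
  have [[eta' Ae']|nA] := pselect (exists eta', allowed R L eta').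
    by rewrite hN//; have := le_trans (normr_ge0 _) (gM _ Ae'); lra.
  move/eqP: muA; rewrite (_ : allowed R L = set0) ?measure0 ?(eq_sym 0%E) ?onee_eq0//.
  by apply/seteqP; split=> // xi Axi; apply: nA; exists xi.
have := @harmonic_invariant _ _ _ mu L allowed_step h (M + M)
  measurable_allowed_step (fun x B => normalized_volume_step x vmu) mh h_itv.
have n0 : n%:R != 0 :> R by rewrite pnatr_eq0 -lt0n card_sites_gt0.
have harm' : {ae mu, forall eta, \sum_x h (allowed_step x eta) = n%:R * h eta}.
  apply: filterS harm => eta harm.
  have [Ae|Ae] := pselect (allowed R L eta).
    rewrite (eq_bigr (fun x => g (add_op a x eta) + M)) => [|x _].
      rewrite big_split/= sumr_const hE// mulrDr -harm// mulrA divff// mul1r.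
      by rewrite mulr_natl.
    by rewrite allowed_stepE// hE//; exact: allowed_add_op.
  rewrite hN// mulr0 big1// => x _; rewrite /allowed_step.
  by case: pselect => // ?; rewrite hN.
move=> /(_ harm') [N [mN N0 Nh]].
have [c hc] : exists c, {ae mu, forall eta, h eta = c}.
  apply: (zero_one_constant mh (M := M + M)) => [eta|r].
    by have /andP[h0 ?] := h_itv eta; rewrite ger0_norm.
  apply: (@normalized_volume_zero_one _ _ (allowed R L `&` ~` N)) => //.
  - rewrite (_ : [set eta | _] = h @^-1` `]-oo, r[).
      by rewrite -[X in measurable X]setTI; exact: mh.
    by apply/seteqP; split=> t /=; rewrite in_itv.
  - by apply: measurableI => //; exact: measurableC.
  - rewrite (probability1_setI mA (measurableC mN) muA) probability_setC// N0.
    by rewrite sube0.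
  move=> eta x [Ae nN]; rewrite /= -allowed_stepE//.
  suff -> : h (allowed_step x eta) = h eta by [].
  by apply: contrapT => neq; apply: nN; apply: Nh => /(_ x).
exists (c - M); apply: filterS hc => eta hc Ae.
by rewrite -hc hE// addrK.
Qed.

End Main.

Theorem theorem2p6 (R : realType) (d : nat) (L : {fset 'rV[int]_d}) (a : R)
    (d_ge1 : (1 <= d)%N) (L_neq0 : L != fset0)
    (a_ge0 : 0 <= a) (a_lt1 : a < 1) (a_irr : irrational a) :
  exists mu : probability (config R L) R,
    [/\ normalized_volume mu,
        invariant_probability a mu,
        forall nu : probability (config R L) R, invariant_probability a nu ->
          forall B, measurable B -> nu B = mu B &
        ergodic a mu].
Proof.
have a_gt0 : 0 < a.
  rewrite lt_neqAle a_ge0 andbT; apply/eqP => a0; apply: a_irr.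
  by exists 0 => //; rewrite -a0 rmorph0.
have [mu vmu] := normalized_volume_exists R L d_ge1.
have inv := normalized_volume_invariant d_ge1 L_neq0 a_gt0 vmu.
exists mu; split=> // [nu inv'|].
  exact: (invariant_unique d_ge1 L_neq0 a_gt0 a_irr inv' inv).
exact: (normalized_volume_ergodic d_ge1 L_neq0 a_gt0 a_irr vmu).
Qed.
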